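(* Let $L$ be an $n$-dimensional nilpotent Lie algebra of nilpotency class two with derived subalgebra $L^2$ of dimension $m$. Then $\dim \mathcal{M}(L)=\frac{1}{2}(n+m-2)(n-m-1)+1$ if and only if $L$ is isomorphic to one of the Lie algebras $H(1)\oplus A(n-3)$, $L_{5,8}$ or $L_{6,26}$.
   Context: Lie algebras are over a fixed field. $L^2=[L,L]$ is the derived subalgebra. The Schur multiplier of $L$ is the abelian Lie algebra $\mathcal{M}(L)=(R\cap F^2)/[R,F]$, where $L\cong F/R$ with $F$ a free Lie algebra (independent of the choice of free presentation up to isomorphism). $A(k)$ denotes the abelian Lie algebra of dimension $k$. $H(1)$ is the Heisenberg Lie algebra of dimension $3$, with basis $x,y,z$ and only non-zero product of basis elements $[x,y]=z$. $L_{5,8}$ has basis $x_1,\ldots,x_5$ with non-zero products $[x_1,x_2]=x_4$, $[x_1,x_3]=x_5$. $L_{6,26}$ has basis $x_1,\ldots,x_6$ with non-zero products $[x_1,x_2]=x_4$, $[x_1,x_3]=x_5$, $[x_2,x_3]=x_6$. (Products of basis elements not listed are zero, up to antisymmetry.) *)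

(* Defs.v *)
From HB Require Import structures.
From mathcomp Require Import all_boot all_order all_algebra.
From mathcomp Require Import boolp classical_sets ring.

Set Implicit Arguments.
Unset Strict Implicit.
Unset Printing Implicit Defensive.

Import GRing.Theory.
Local Open Scope ring_scope.
Local Open Scope classical_set_scope.

HB.mixin Record isLieAlgebra (K : fieldType) L of GRing.Lmodule K L := {
  lie : L -> L -> L;
  lie_linearl : forall y, linear (lie^~ y);
  lie_linearr : forall x, linear (lie x);
  (* alternating, not merely antisymmetric: [K] may have characteristic 2 *)
  liexx : forall x, lie x x = 0;
  lie_jacobi : forall x y z,
    lie x (lie y z) + lie y (lie z x) + lie z (lie x y) = 0
}.

#[short(type="lieAlgType")]
HB.structure Definition LieAlgebra (K : fieldType) :=
  {L of isLieAlgebra K L & GRing.Lmodule K L}.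

#[short(type="finLieAlgType")]
HB.structure Definition FinLieAlgebra (K : fieldType) :=
  {L of LieAlgebra K L & Vector K L}.

Definition lie_morphism (K : fieldType) (L M : lieAlgType K) (f : L -> M) :=
  forall x y, f (lie x y) = lie (f x) (f y).

Definition lie_isomorphic (K : fieldType) (L M : lieAlgType K) : Prop :=
  exists f : {linear L -> M}, lie_morphism f /\ bijective f.

Section Subspaces.
Variables (K : fieldType) (V : lmodType K).

Definition subspace (W : set V) : Prop :=
  W 0 /\ forall (a : K) u v, W u -> W v -> W (a *: u + v).

Definition lspan (S : set V) : set V := smallest subspace S.

(* The quotient space A / B has dimension d; meant for subspaces B of A. *)
Definition dim_quotient (A B : set V) (d : nat) : Prop :=
  exists v : 'I_d -> V,
    [/\ forall i, A (v i),
        forall a, A a -> exists c : 'I_d -> K, B (a - \sum_i c i *: v i)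
      & forall c : 'I_d -> K, B (\sum_i c i *: v i) -> forall i, c i = 0].

Definition has_dim (A : set V) (d : nat) : Prop := dim_quotient A [set 0] d.

End Subspaces.

Section LieSubspaces.
Variables (K : fieldType) (L : lieAlgType K).

Definition lie_prod (A B : set L) : set L :=
  lspan [set lie a b | a in A & b in B].

Definition derived : set L := lie_prod setT setT.

(* [lower_central i] is the (i + 1)-st term: L, [L, L], [[L, L], L], ... *)
Fixpoint lower_central (i : nat) : set L :=
  if i is j.+1 then lie_prod (lower_central j) setT else setT.

Definition nilpotent_of_class (c : nat) : Prop :=
  lower_central c = [set 0] /\
  forall i, (i < c)%N -> lower_central i <> [set 0].

End LieSubspaces.
Arguments derived {K} L.
Arguments nilpotent_of_class {K} L c.

Definition free_lie_algebra (K : fieldType) (X : Type) (F : lieAlgType K)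
    (gen : X -> F) : Prop :=
  forall (M : lieAlgType K) (g : X -> M),
    exists f : {linear F -> M},
      [/\ lie_morphism f, forall x, f (gen x) = g x
        & forall f' : {linear F -> M},
            lie_morphism f' -> (forall x, f' (gen x) = g x) -> f' =1 f].

Record free_presentation (K : fieldType) (L : lieAlgType K) :=
  FreePresentation {
    pres_gens : Type;
    pres_free : lieAlgType K;
    pres_gen : pres_gens -> pres_free;
    pres_freeP : free_lie_algebra pres_gen;
    pres_map : {linear pres_free -> L};
    pres_mapM : lie_morphism pres_map;
    pres_map_surj : forall y : L, exists x : pres_free, pres_map x = y
  }.

Section SchurMultiplier.
Variables (K : fieldType) (L : lieAlgType K) (P : free_presentation L).

Definition relations : set (pres_free P) := [set x | pres_map P x = 0].

(* dim ((R `&` F^2) / [R, F]) = d, where L = F / R is the presentation P *)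
Definition dim_schur_multiplier (d : nat) : Prop :=
  dim_quotient (relations `&` derived (pres_free P))
               (lie_prod relations setT) d.

End SchurMultiplier.

Section DirectSum.
Variables (K : fieldType) (L M : lieAlgType K).

Definition dsum_lie (u v : L * M) : L * M := (lie u.1 v.1, lie u.2 v.2).

Fact dsum_lie_linearl v : linear (dsum_lie^~ v).
Proof.
move=> a u w; rewrite /dsum_lie /= (lie_linearl v.1) (lie_linearl v.2).
by [].
Qed.

Fact dsum_lie_linearr u : linear (dsum_lie u).
Proof.
move=> a v w; rewrite /dsum_lie /= (lie_linearr u.1) (lie_linearr u.2).
by [].
Qed.

Fact dsum_liexx u : dsum_lie u u = 0.
Proof. by rewrite /dsum_lie !liexx. Qed.

Fact dsum_jacobi u v w :
  dsum_lie u (dsum_lie v w) + dsum_lie v (dsum_lie w u)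
    + dsum_lie w (dsum_lie u v) = 0.
Proof.
rewrite /dsum_lie /=.
by congr (_, _); rewrite /= lie_jacobi.
Qed.

HB.instance Definition _ := isLieAlgebra.Build K (L * M)%type
  dsum_lie_linearl dsum_lie_linearr dsum_liexx dsum_jacobi.

End DirectSum.

(* A triple (i, j, k) of the table t stands for the product [e_i, e_j] = e_k  *)
(* of vectors of the standard basis e_0, ..., e_n; products of basis vectors  *)
(* that t does not determine up to antisymmetry are zero.                     *)
Section TableLie.
Variables (K : fieldType) (n : nat) (t : seq (nat * nat * nat)).
Implicit Types u v w : 'rV[K]_n.+1.

Definition table_lie u v : 'rV[K]_n.+1 :=
  \sum_(p <- t) (u 0 (inord p.1.1) * v 0 (inord p.1.2)
                 - u 0 (inord p.1.2) * v 0 (inord p.1.1))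
                *: delta_mx 0 (inord p.2).

(* The basis vectors that occur as values have only zero products. *)
Definition central_table : bool :=
  all (fun p => (p.2 <= n)%N &&
         all (fun q => [&& (q.1.1 <= n)%N, (q.1.2 <= n)%N,
                           p.2 != q.1.1 & p.2 != q.1.2]) t) t.

Fact table_lie_linearl v : linear (table_lie^~ v).
Proof.
move=> a u w; rewrite /table_lie scaler_sumr -big_split /=.
apply: eq_bigr => p _; rewrite !mxE scalerA -scalerDl; congr (_ *: _).
by ring.
Qed.

Fact table_lie_linearr u : linear (table_lie u).
Proof.
move=> a v w; rewrite /table_lie scaler_sumr -big_split /=.
apply: eq_bigr => p _; rewrite !mxE scalerA -scalerDl; congr (_ *: _).
by ring.
Qed.

Fact table_liexx u : table_lie u u = 0.
Proof.
rewrite /table_lie big1 // => p _.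
by rewrite (mulrC (u 0 (inord p.1.2))) subrr scale0r.
Qed.

Fact table_lie_central : central_table ->
  forall u v w, table_lie u (table_lie v w) = 0.
Proof.
move=> /allP ct u v w; rewrite /table_lie big_seq big1 // => q qt.
suff zero (i : nat) : i = q.1.1 \/ i = q.1.2 ->
    (\sum_(p <- t) (v 0 (inord p.1.1) * w 0 (inord p.1.2)
      - v 0 (inord p.1.2) * w 0 (inord p.1.1)) *:
        delta_mx 0 (inord p.2) : 'rV[K]_n.+1) 0 (inord i) = 0.
  by rewrite !zero ?mulr0 ?subrr ?scale0r //; [left|right].
move=> iq; rewrite summxE big_seq big1 // => p pt; rewrite !mxE /=.
have /andP[p2n /allP/(_ q qt)/and4P[q1n q2n pq1 pq2]] := ct p pt.
suff /negPf-> : inord i != inord p.2 :> 'I_n.+1 by rewrite mulr0.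
rewrite -val_eqE /= !inordK ?ltnS // 1?eq_sym; first by case: iq => ->.
by case: iq => ->.
Qed.

Fact table_jacobi : central_table -> forall u v w,
  table_lie u (table_lie v w) + table_lie v (table_lie w u)
    + table_lie w (table_lie u v) = 0.
Proof. by move=> ct u v w; rewrite !table_lie_central // !addr0. Qed.

End TableLie.

Section Examples.
Variable K : fieldType.

Definition abelian_lie (k : nat) : Type := 'rV[K]_k.
HB.instance Definition _ k := Vector.on (abelian_lie k).

Definition abelian_bracket {k} (u v : abelian_lie k) : abelian_lie k := 0.

Fact abelian_linearl k (v : abelian_lie k) : linear (abelian_bracket^~ v).
Proof. by move=> a u w; rewrite /abelian_bracket scaler0 addr0. Qed.

Fact abelian_linearr k (u : abelian_lie k) : linear (abelian_bracket u).
Proof. by move=> a v w; rewrite /abelian_bracket scaler0 addr0. Qed.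

Fact abelian_liexx k (u : abelian_lie k) : abelian_bracket u u = 0.
Proof. by []. Qed.

Fact abelian_jacobi k (u v w : abelian_lie k) :
  abelian_bracket u (abelian_bracket v w)
    + abelian_bracket v (abelian_bracket w u)
    + abelian_bracket w (abelian_bracket u v) = 0.
Proof. by rewrite /abelian_bracket !addr0. Qed.

HB.instance Definition _ k := isLieAlgebra.Build K (abelian_lie k)
  (@abelian_linearl k) (@abelian_linearr k)
  (@abelian_liexx k) (@abelian_jacobi k).

(* [x, y] = z *)
Definition table_H1 : seq (nat * nat * nat) := [:: (0, 1, 2)]%N.
Definition heisenberg1 : Type := 'rV[K]_3.
HB.instance Definition _ := Vector.on heisenberg1.
HB.instance Definition _ := isLieAlgebra.Build K heisenberg1
  (@table_lie_linearl K 2 table_H1) (@table_lie_linearr K 2 table_H1)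
  (@table_liexx K 2 table_H1) (@table_jacobi K 2 table_H1 isT).

(* [x_1, x_2] = x_4, [x_1, x_3] = x_5, with x_i the basis vector e_(i - 1) *)
Definition table_L58 : seq (nat * nat * nat) := [:: (0, 1, 3); (0, 2, 4)]%N.
Definition lie_L58 : Type := 'rV[K]_5.
HB.instance Definition _ := Vector.on lie_L58.
HB.instance Definition _ := isLieAlgebra.Build K lie_L58
  (@table_lie_linearl K 4 table_L58) (@table_lie_linearr K 4 table_L58)
  (@table_liexx K 4 table_L58) (@table_jacobi K 4 table_L58 isT).

(* [x_1, x_2] = x_4, [x_1, x_3] = x_5, [x_2, x_3] = x_6 *)
Definition table_L626 : seq (nat * nat * nat) :=
  [:: (0, 1, 3); (0, 2, 4); (1, 2, 5)]%N.
Definition lie_L626 : Type := 'rV[K]_6.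
HB.instance Definition _ := Vector.on lie_L626.
HB.instance Definition _ := isLieAlgebra.Build K lie_L626
  (@table_lie_linearl K 5 table_L626) (@table_lie_linearr K 5 table_L626)
  (@table_liexx K 5 table_L626) (@table_jacobi K 5 table_L626 isT).

End Examples.

(* Main.v *)
(* For generators x, y, z of L modulo L^2 let J(x, y, z) be the element
   x (x) [y, z] + y (x) [z, x] + z (x) [x, y] of (L / L^2) (x) L^2, let r be the
   dimension of the span of these elements, and put d = n - m. Since L has class
   two, F^2 / [R, F] is isomorphic to the direct sum of the exterior square of
   L / L^2 and ((L / L^2) (x) L^2) / <J>: the isomorphism is built from the
   2-cocycle of L with values in that space, which becomes a coboundary on the
   free algebra F. As (R `&` F^2) / [R, F] is the kernel of F^2 / [R, F] -> L^2,
   dim M(L) = C(d, 2) - m + d m - r, and the stated equality says r = d - 2.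

   If z = [x, y] <> 0, the elements J(x, y, e) for e in the remaining d - 2
   generators are independent, so they span all J when r = d - 2. If then all
   [x, e] and [y, e] are multiples of z, x and y split off as a factor H(1) and
   the rest is abelian. Otherwise d = 3, and L is L_{5,8} or L_{6,26} according
   to whether the three brackets of generators are dependent. *)
From HB Require Import structures.
Require Import Defs.
From mathcomp Require Import all_boot all_order all_algebra.
From mathcomp Require Import boolp classical_sets.
From mathcomp Require Import ring lra zify.

Set Implicit Arguments.
Unset Strict Implicit.
Unset Printing Implicit Defensive.

Import GRing.Theory.
Local Open Scope ring_scope.
Local Open Scope classical_set_scope.

(** * Subspaces and central extensions *)

Section SubspaceTheory.
Variables (K : fieldType) (V : lmodType K).
Implicit Types A B S W : set V.

Lemma subspace0 W : subspace W -> W 0.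
Proof. by case. Qed.

Lemma subspaceZ W a x : subspace W -> W x -> W (a *: x).
Proof. by move=> [W0 WP] Wx; rewrite -[_ *: _]addr0; apply: WP. Qed.

Lemma subspaceD W x y : subspace W -> W x -> W y -> W (x + y).
Proof. by move=> [W0 WP] Wx Wy; rewrite -[x]scale1r; apply: WP. Qed.

Lemma subspaceN W x : subspace W -> W x -> W (- x).
Proof. by move=> sW Wx; rewrite -scaleN1r; apply: subspaceZ. Qed.

Lemma subspaceB W x y : subspace W -> W x -> W y -> W (x - y).
Proof. by move=> sW Wx Wy; apply: subspaceD => //; apply: subspaceN. Qed.

Lemma subspace_sum W (I : Type) (r : seq I) (P : pred I) (F : I -> V) :
  subspace W -> (forall i, P i -> W (F i)) -> W (\sum_(i <- r | P i) F i).
Proof.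
move=> sW WF; apply: big_ind => //; first exact: subspace0.
by move=> x y; apply: subspaceD.
Qed.

Lemma lspan_subspace S : subspace (lspan S).
Proof.
split=> [W [[W0 _] _] //|a x y Sx Sy W SW].
by case: (SW) => -[_ WP] _; apply: WP; [apply: Sx|apply: Sy].
Qed.

Lemma sub_lspan S x : S x -> lspan S x.
Proof. exact: sub_gen_smallest. Qed.

Lemma lspan_ind S W : subspace W -> (forall x, S x -> W x) ->
  forall x, lspan S x -> W x.
Proof. exact: smallest_sub. Qed.

Lemma subspaceI A B : subspace A -> subspace B -> subspace (A `&` B).
Proof.
move=> [A0 AP] [B0 BP]; split=> // a x y [Ax Bx] [Ay By].
by split; [apply: AP|apply: BP].
Qed.

Lemma subspace_ker (U : lmodType K) (f : {linear V -> U}) :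
  subspace [set x | f x = 0].
Proof. by split=> /= [|a x y fx fy]; rewrite ?linear0 // linearP fx fy scaler0 addr0. Qed.

Lemma subspace_vspace (W : vectType K) (U : {vspace W}) : subspace [set w | w \in U].
Proof. by split=> /= [|a x y xU yU]; rewrite ?mem0v // memvD ?memvZ. Qed.

(** By the first isomorphism theorem [f] identifies [A] / [B] with [U]. As [V] may be
    infinite-dimensional, like a free Lie algebra, dimensions of quotients are read off from a map
    to a finite-dimensional space. *)
Lemma dim_quotient_image (W : vectType K) (f : {linear V -> W}) (U : {vspace W})
    A B k :
    (forall x, A x -> f x \in U) ->
    (forall w, w \in U -> exists2 x, A x & f x = w) ->
    subspace A -> (forall x, A x -> B x <-> f x = 0) -> (B `<=` A) ->
  dim_quotient A B k <-> k = \dim U.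
Proof.
move=> fU Uf sA Bf BA; split=> [[v [Av spanv freev]]|->].
  suff /size_basis-> : basis_of U [tuple f (v i) | i < k] by [].
  apply/andP; split; last first.
    apply/freeP=> c c0; apply: freev; apply/Bf.
      by apply: subspace_sum => // i _; apply: subspaceZ.
    rewrite linear_sum -[RHS]c0; apply: eq_bigr => i _.
    by rewrite linearZ (nth_map i) ?size_enum_ord // nth_ord_enum.
  rewrite eqEsubv; apply/andP; split.
    by apply/span_subvP => _ /mapP[i _ ->]; apply: fU.
  apply/subvP => w /Uf[x Ax <-]; have [c cB] := spanv x Ax.
  have /(Bf _ (BA _ cB)) : B (x - \sum_i c i *: v i) by [].
  rewrite linearB => /eqP; rewrite subr_eq0 => /eqP->.
  rewrite linear_sum; apply: memv_suml => i _; rewrite linearZ memvZ //.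
  by apply/memv_span/mapP; exists i; rewrite ?mem_enum.
have /choice[v vP] (i : 'I_(\dim U)) : exists x, A x /\ f x = (vbasis U)`_i.
  have [|x Ax fx] := Uf (vbasis U)`_i; last by exists x.
  by rewrite vbasis_mem // mem_nth // size_tuple.
have sumE c : f (\sum_i c i *: v i) = \sum_i c i *: (vbasis U)`_i.
  by rewrite linear_sum; apply: eq_bigr => i _; rewrite linearZ (vP i).2.
exists v; split=> [i|x Ax|c]; first by have [] := vP i.
- exists (coord (vbasis U) ^~ (f x)); apply/Bf.
    apply: subspaceB => //; apply: subspace_sum => // i _.
    by apply: subspaceZ => //; have [] := vP i.
  by rewrite linearB sumE -coord_vbasis ?subrr ?fU.
move=> Bc; have /Bf : A (\sum_i c i *: v i) by apply: BA.
move=> [/(_ Bc)]; rewrite sumE => c0 _.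
by move/freeP: (basis_free (vbasisP U)); apply.
Qed.

End SubspaceTheory.
Arguments subspaceZ {K V W} [a x].
Arguments subspace_sum {K V W I} [r P F].

Section LieTheory.
Variables (K : fieldType) (L : lieAlgType K).
Implicit Types x y z : L.

Lemma lie0l y : lie 0 y = 0 :> L.
Proof. by have := lie_linearl y (-1) 0 0; rewrite /= scaler0 addr0 scaleN1r addNr. Qed.

Lemma lieDl x y z : lie (x + y) z = lie x z + lie y z.
Proof. by have := lie_linearl z 1 x y; rewrite /= !scale1r. Qed.

Lemma lieZl a x y : lie (a *: x) y = a *: lie x y.
Proof. by have := lie_linearl y a x 0; rewrite /= addr0 lie0l addr0. Qed.

Lemma lie0r x : lie x 0 = 0 :> L.
Proof. by have := lie_linearr x (-1) 0 0; rewrite /= scaler0 addr0 scaleN1r addNr. Qed.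

Lemma lieDr x y z : lie x (y + z) = lie x y + lie x z.
Proof. by have := lie_linearr x 1 y z; rewrite /= !scale1r. Qed.

Lemma lieZr a x y : lie x (a *: y) = a *: lie x y.
Proof. by have := lie_linearr x a y 0; rewrite /= addr0 lie0r addr0. Qed.

Lemma lieNl x y : lie (- x) y = - lie x y.
Proof. by rewrite -scaleN1r lieZl scaleN1r. Qed.

Lemma lieNr x y : lie x (- y) = - lie x y.
Proof. by rewrite -scaleN1r lieZr scaleN1r. Qed.

Lemma lieC x y : lie y x = - lie x y.
Proof.
have := liexx (x + y); rewrite lieDl !lieDr !liexx add0r addr0 addrC => /eqP.
by rewrite addr_eq0 => /eqP.
Qed.

Lemma lie_suml I (r : seq I) (P : pred I) (F : I -> L) y :
  lie (\sum_(i <- r | P i) F i) y = \sum_(i <- r | P i) lie (F i) y.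
Proof.
by apply: (big_morph (fun x => lie x y)); [move=> *; apply: lieDl|apply: lie0l].
Qed.

Lemma lie_sumr I (r : seq I) (P : pred I) (F : I -> L) y :
  lie y (\sum_(i <- r | P i) F i) = \sum_(i <- r | P i) lie y (F i).
Proof. by apply: (big_morph (lie y)); [move=> *; apply: lieDr|apply: lie0r]. Qed.

Lemma lie_prodP (A B : set L) x y : A x -> B y -> lie_prod A B (lie x y).
Proof. by move=> Ax By; apply: sub_lspan; exists x => //; exists y. Qed.

Lemma derivedP x y : derived L (lie x y).
Proof. exact: lie_prodP. Qed.

Lemma derived_subspace : subspace (derived L).
Proof. exact: lspan_subspace. Qed.

Lemma derived_ind (W : set L) : subspace W -> (forall x y, W (lie x y)) ->
  forall x, derived L x -> W x.
Proof. by move=> sW lW; apply: (lspan_ind sW) => _ [x _ [y _ <-]]. Qed.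

End LieTheory.

Section CocycleExtension.
Variables (K : fieldType) (L : lieAlgType K) (W : lmodType K).

Record cocycle := Cocycle {
  cocycle_fun :> L -> L -> W;
  cocycle_linearl : forall y, linear (cocycle_fun^~ y);
  cocycle_linearr : forall x, linear (cocycle_fun x);
  cocyclexx : forall x, cocycle_fun x x = 0;
  cocycle_jacobi : forall x y z,
    cocycle_fun x (lie y z) + cocycle_fun y (lie z x) + cocycle_fun z (lie x y) = 0
}.

(** The carrier does not depend on [c] but the bracket does; keeping [c] as an argument of the type
    lets the Lie structure be attached to it. *)
Definition cocycle_ext (c : cocycle) : Type := (L * W)%type.

Variable c : cocycle.
HB.instance Definition _ := GRing.Lmodule.on (cocycle_ext c).

Definition ext_lie (x y : cocycle_ext c) : cocycle_ext c := (lie x.1 y.1, c x.1 y.1).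

Fact ext_lie_linearl y : linear (ext_lie^~ y).
Proof.
by move=> a x x'; rewrite /ext_lie /= (lie_linearl y.1) (cocycle_linearl c y.1).
Qed.

Fact ext_lie_linearr x : linear (ext_lie x).
Proof.
by move=> a y y'; rewrite /ext_lie /= (lie_linearr x.1) (cocycle_linearr c x.1).
Qed.

Fact ext_liexx x : ext_lie x x = 0.
Proof. by rewrite /ext_lie liexx cocyclexx. Qed.

Fact ext_jacobi x y z :
  ext_lie x (ext_lie y z) + ext_lie y (ext_lie z x) + ext_lie z (ext_lie x y) = 0.
Proof.
by congr (_, _); rewrite /= ?lie_jacobi ?cocycle_jacobi.
Qed.

HB.instance Definition _ := isLieAlgebra.Build K (cocycle_ext c)
  ext_lie_linearl ext_lie_linearr ext_liexx ext_jacobi.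

(* Free Lie algebras have trivial second cohomology: lift the given morphism *)
(* to the central extension defined by the cocycle. *)
Lemma free_cocycle_trivial (X : Type) (F : lieAlgType K) (gen : X -> F)
    (p : {linear F -> L}) : free_lie_algebra gen -> lie_morphism p ->
  exists t : {linear F -> W}, forall x y, t (lie x y) = c (p x) (p y).
Proof.
move=> freeF pM.
have [f [fM fgen _]] := freeF (cocycle_ext c) (fun x => (p (gen x), 0)).
have [g [gM ggen gU]] := freeF L (fun x => p (gen x)).
pose f1 x := (f x).1; pose f2 x := (f x).2.
have f1L : linear f1 by move=> a x y; rewrite /f1 linearP.
have f2L : linear f2 by move=> a x y; rewrite /f2 linearP.
pose F1 : {linear F -> L} := HB.pack f1 (GRing.isLinear.Build _ _ _ _ f1 f1L).
pose F2 : {linear F -> W} := HB.pack f2 (GRing.isLinear.Build _ _ _ _ f2 f2L).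
(* The first component of [f] and [p] are morphisms to [L] that agree on generators, so they
   coincide by uniqueness; the second component of [f] then carries the cocycle. *)
have f1E : f1 =1 p.
  move=> x; rewrite (gU p) //; apply: (gU F1) => [y z|y] /=.
    by rewrite /f1 fM.
  by rewrite /f1 fgen.
exists F2 => x y; rewrite /= /f2 fM /= -!f1E.
by [].
Qed.

End CocycleExtension.

(** * Adapted coordinates on a Lie algebra of class two *)

Definition lt_pair d := [pred p : 'I_d * 'I_d | (p.1 < p.2)%N].
(** Pairs [i < j] index the standard basis of the exterior square of a space of dimension [d]. *)
Definition pairs d : Type := {p | p \in lt_pair d}.
HB.instance Definition _ d := SubFinite.on (pairs d).

Lemma card_pairs d : #|{: pairs d}| = 'C(d, 2).
Proof.
rewrite card_sig -sum1_card (eq_bigl (lt_pair d)) //.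
rewrite -(pair_big_dep xpredT (fun i j : 'I_d => (i < j)%N) (fun=> fun=> 1%N)) /=.
rewrite (exchange_big_dep xpredT) //= -bin2_sum big_mkord; apply: eq_bigr => j _.
rewrite sum1_card -[RHS]card_ord.
rewrite -(card_image (f := widen_ord (ltnW (ltn_ord j)))); last first.
  by move=> x y /(congr1 val)/= /val_inj.
apply: eq_card => i; rewrite unfold_in /=; apply/idP/mapP => [ij|[k _ ->]]; last first.
  exact: (ltn_ord k).
by exists (Ordinal ij); rewrite ?mem_enum //; apply: val_inj.
Qed.

(** Diagonal terms vanish and each term with [i > j] is swapped onto its mirror image. In
    characteristic 2 the vanishing of [B i i] does not follow from antisymmetry. *)
Lemma sum_alternating (K : fieldType) (M : lmodType K) d (a b : 'I_d -> K)
    (B : 'I_d -> 'I_d -> M) :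
  (forall i, B i i = 0) -> (forall i j, B j i = - B i j) ->
  \sum_i \sum_j (a i * b j) *: B i j =
  \sum_(t : pairs d) (a (val t).1 * b (val t).2 - a (val t).2 * b (val t).1)
     *: B (val t).1 (val t).2.
Proof.
move=> Bii BC; rewrite pair_bigA /=.
rewrite -(big_sub _ (fun p => (a p.1 * b p.2 - a p.2 * b p.1) *: B p.1 p.2)) /=.
rewrite (bigID (fun p : 'I_d * 'I_d => p.1 < p.2)%N) /=.
rewrite [X in _ + X](bigID (fun p : 'I_d * 'I_d => p.1 == p.2)) /=.
rewrite [X in _ + (X + _)]big1 ?add0r.
  rewrite [X in _ + X](reindex_inj (can_inj (@swap_pairK _ _))) /=.
  rewrite [X in _ + X](eq_bigl (fun p : 'I_d * 'I_d => p.1 < p.2)%N) => [|p].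
    rewrite -big_split /=; apply: eq_bigr => p _.
    by rewrite (BC p.1) scalerN scalerBl.
  by rewrite /= -leqNgt eq_sym [RHS]ltn_neqAle andbC.
by move=> p /andP[_ /eqP->]; rewrite Bii scaler0.
Qed.

(** The [cX i] form a basis of a complement of L^2 and the [cY k] a basis of L^2. The fields
    [cv_lie] and [cv0_derived] make L^2 the kernel of [cv], and [lie_cv0] makes it central, which is
    where class two enters. *)
Record coords (K : fieldType) (L : lieAlgType K) (d m : nat) := Coords {
  cX : 'I_d -> L;
  cY : 'I_m -> L;
  cv : {linear L -> 'rV[K]_d};
  cu : {linear L -> 'rV[K]_m};
  coordsE : forall l, l = \sum_i cv l 0 i *: cX i + \sum_k cu l 0 k *: cY k;
  cvX : forall i, cv (cX i) = delta_mx 0 i;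
  cvY : forall k, cv (cY k) = 0;
  cuX : forall i, cu (cX i) = 0;
  cuY : forall k, cu (cY k) = delta_mx 0 k;
  cv_lie : forall l l', cv (lie l l') = 0;
  lie_cv0 : forall l l', cv l = 0 -> lie l l' = 0;
  cv0_derived : forall l, cv l = 0 -> derived L l
}.

Section Coordinates.
Variables (K : fieldType) (L : lieAlgType K) (d m : nat) (C : coords L d m).
Local Notation X := (cX C).
Local Notation Y := (cY C).
Local Notation v := (cv C).
Local Notation u := (cu C).
Implicit Types l : L.

Lemma cv_derived l : derived L l -> v l = 0.
Proof.
by apply: (derived_ind (subspace_ker v)) => x y; apply: cv_lie.
Qed.

Lemma lie_cv0r l l' : v l' = 0 -> lie l l' = 0.
Proof. by move=> vl'; rewrite lieC (lie_cv0 (c := C)) ?oppr0. Qed.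

Lemma coords_lie l l' :
  lie l l' = \sum_i \sum_j (v l 0 i * v l' 0 j) *: lie (X i) (X j).
Proof.
rewrite {1}(coordsE C l) lieDl (@lie_cv0 _ _ _ _ C (\sum_(k < m) _)) ?addr0; last first.
  by rewrite linear_sum big1 // => k _; rewrite linearZ /= cvY scaler0.
rewrite lie_suml; apply: eq_bigr => i _; rewrite lieZl.
rewrite {1}(coordsE C l') lieDr (@lie_cv0r _ (\sum_(k < m) _)) ?addr0; last first.
  by rewrite linear_sum big1 // => k _; rewrite linearZ /= cvY scaler0.
rewrite lie_sumr scaler_sumr; apply: eq_bigr => j _.
by rewrite lieZr scalerA.
Qed.

(** A [d] by [m] matrix stands for a tensor in (L / L^2) (x) L^2, the product of a column and a row
    being a pure tensor; this one is J(l1, l2, l3). *)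
Definition jacobi_mx l1 l2 l3 : 'M[K]_(d, m) :=
  (v l1)^T *m u (lie l2 l3) + (v l2)^T *m u (lie l3 l1) + (v l3)^T *m u (lie l1 l2).

Lemma jacobi_mx_cycle l1 l2 l3 : jacobi_mx l1 l2 l3 = jacobi_mx l2 l3 l1.
Proof. by rewrite /jacobi_mx -addrA addrC. Qed.

Lemma jacobi_mxxx l l' : jacobi_mx l l l' = 0.
Proof.
by rewrite /jacobi_mx liexx linear0 mulmx0 addr0 (lieC l l') linearN mulmxN subrr.
Qed.

(** As L^2 is central and is the kernel of [v], the matrix depends on [l1] only modulo L^2. Cyclic
    symmetry extends this to the other two arguments. *)
Lemma jacobi_mx_expand l1 l2 l3 :
  jacobi_mx l1 l2 l3 = \sum_i v l1 0 i *: jacobi_mx (X i) l2 l3.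
Proof.
have J0 l : v l = 0 -> jacobi_mx l l2 l3 = 0.
  move=> l0; rewrite /jacobi_mx l0 trmx0 mul0mx add0r.
  have -> : lie l l2 = 0 by apply: lie_cv0 l0.
  by rewrite lie_cv0r // linear0 !mulmx0 addr0.
have JD x y : jacobi_mx (x + y) l2 l3 = jacobi_mx x l2 l3 + jacobi_mx y l2 l3.
  rewrite /jacobi_mx lieDl lieDr !linearD /= mulmxDl.
  by rewrite [RHS]addrACA; congr (_ + _); rewrite addrACA.
have JZ a x : jacobi_mx (a *: x) l2 l3 = a *: jacobi_mx x l2 l3.
  rewrite /jacobi_mx lieZl lieZr !linearZ /= -scalemxAl.
  by rewrite !scalerDr.
rewrite {1}(coordsE C l1) JD (J0 (\sum_(k < m) _)) ?addr0; last first.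
  by rewrite linear_sum big1 // => k _; rewrite linearZ /= cvY scaler0.
rewrite (big_morph (fun x => jacobi_mx x l2 l3) JD (J0 0 (linear0 _))).
by apply: eq_bigr => i _; rewrite JZ.
Qed.

Lemma jacobi_mx_mem (U : {vspace 'M[K]_(d, m)}) :
  (forall i j k, jacobi_mx (X i) (X j) (X k) \in U) ->
  forall l1 l2 l3, jacobi_mx l1 l2 l3 \in U.
Proof.
move=> XU l1 l2 l3.
rewrite jacobi_mx_expand memv_suml // => i _; rewrite memvZ // jacobi_mx_cycle.
rewrite jacobi_mx_expand memv_suml // => j _; rewrite memvZ // jacobi_mx_cycle.
rewrite jacobi_mx_expand memv_suml // => k _; rewrite memvZ // jacobi_mx_cycle.
Qed.

Definition jacobi_space : {vspace 'M[K]_(d, m)} :=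
  <<[seq jacobi_mx (X p.1.1) (X p.1.2) (X p.2) | p : 'I_d * 'I_d * 'I_d]>>%VS.

Lemma mem_jacobi_space l1 l2 l3 : jacobi_mx l1 l2 l3 \in jacobi_space.
Proof.
apply: jacobi_mx_mem => i j k; apply/memv_span/mapP.
by exists (i, j, k); rewrite ?mem_enum.
Qed.

Lemma jacobi_space_sub (U : {vspace 'M[K]_(d, m)}) :
  (forall i j k, jacobi_mx (X i) (X j) (X k) \in U) -> (jacobi_space <= U)%VS.
Proof. by move=> XU; apply/span_subvP => _ /mapP[p _ ->]. Qed.

(* A complement of [jacobi_space] serves as a model of (V * L^2) / J. *)
Definition jacobi_coset : 'M[K]_(d, m) -> 'M[K]_(d, m) :=
  fun g => g - projv jacobi_space g.

Fact jacobi_coset_linear : linear jacobi_coset.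
Proof.
move=> a g h; rewrite /jacobi_coset linearP scalerBr opprD !addrA.
by rewrite [X in X - _]addrAC.
Qed.
HB.instance Definition _ := GRing.isLinear.Build _ _ _ _ jacobi_coset jacobi_coset_linear.

Lemma jacobi_coset_eq0 g : g \in jacobi_space -> jacobi_coset g = 0.
Proof. by move=> gJ; rewrite /jacobi_coset projv_id ?subrr. Qed.

(** The first factor is the exterior square of L / L^2. The second is not divided by [jacobi_space];
    instead [jacobi_coset] takes its values in a complement of that space. *)
Definition wedge_space : vectType K := ({ffun pairs d -> K^o} * 'M[K]_(d, m))%type.

Definition wedge l l' : {ffun pairs d -> K^o} :=
  [ffun t => v l 0 (val t).1 * v l' 0 (val t).2 - v l 0 (val t).2 * v l' 0 (val t).1].

Definition cross_mx l l' : 'M[K]_(d, m) := (v l)^T *m u l' - (v l')^T *m u l.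

Definition cover_fun l l' : wedge_space := (wedge l l', jacobi_coset (cross_mx l l')).

Fact cover_fun_linearl l' : linear (cover_fun^~ l').
Proof.
move=> a x y; congr (_, _).
  by apply/ffunP => t; rewrite !ffunE linearP !mxE /GRing.scale /=; ring.
rewrite /= -linearP /=; congr (jacobi_coset _).
rewrite /cross_mx !linearP /= mulmxDl -scalemxAl.
by rewrite scalerBr scalerN addrACA.
Qed.

Fact cover_funC l l' : cover_fun l' l = - cover_fun l l'.
Proof.
congr (_, _); last by rewrite /= -linearN /=; congr (jacobi_coset _); rewrite /cross_mx opprB.
by apply/ffunP => t; rewrite !ffunE; ring.
Qed.

Fact cover_fun_linearr l : linear (cover_fun l).
Proof.
move=> a x y; rewrite ![cover_fun l _]cover_funC cover_fun_linearl.
by rewrite opprD scalerN.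
Qed.

Fact cover_funxx l : cover_fun l l = 0.
Proof.
congr (_, _); last by rewrite /cross_mx subrr linear0.
by apply/ffunP => t; rewrite !ffunE mulrC subrr.
Qed.

(** The wedge part vanishes because [v] kills brackets. The matrix part is the coset of
    [jacobi_mx C l1 l2 l3], so killing [jacobi_space] is what makes this a cocycle. *)
Fact cover_fun_jacobi l1 l2 l3 :
  cover_fun l1 (lie l2 l3) + cover_fun l2 (lie l3 l1) + cover_fun l3 (lie l1 l2) = 0.
Proof.
congr (_, _).
  by apply/ffunP => t; rewrite !ffunE !cv_lie !mxE; ring.
rewrite /= -2!linearD /=. rewrite jacobi_coset_eq0 // /cross_mx !cv_lie trmx0 !mul0mx !subr0.
exact: mem_jacobi_space.
Qed.

Definition cover_cocycle : cocycle L wedge_space :=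
  Cocycle cover_fun_linearl cover_fun_linearr cover_funxx cover_fun_jacobi.

End Coordinates.

(** * Dimension of the Schur multiplier *)

Lemma span_ind (K : fieldType) (V : vectType K) (s : seq V) (Q : set V) :
  subspace Q -> (forall x, x \in s -> Q x) -> forall x, x \in <<s>>%VS -> Q x.
Proof.
move=> sQ sP x /(@coord_span _ _ _ (in_tuple s)) ->.
by apply: subspace_sum => // i _; apply: subspaceZ => //; apply/sP/mem_nth.
Qed.

Section MultiplierDimension.
Variables (K : fieldType) (L : lieAlgType K) (d m : nat) (C : coords L d m).
Variable P : free_presentation L.
Local Notation X := (cX C).
Local Notation Y := (cY C).
Local Notation v := (cv C).
Local Notation u := (cu C).
Local Notation F := (pres_free P).
Local Notation p := (pres_map P).
Local Notation RF := (lie_prod (@relations K L P) [set: F]).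
Local Notation W := (wedge_space K d m).

Definition bracket_of_wedge (a : {ffun pairs d -> K^o}) : 'rV[K]_m :=
  \sum_(t : pairs d) a t *: u (lie (X (val t).1) (X (val t).2)).

Fact bracket_of_wedge_linear : linear bracket_of_wedge.
Proof.
move=> k a b; rewrite /bracket_of_wedge scaler_sumr -big_split /=.
by apply: eq_bigr => t _; rewrite !ffunE scalerA -scalerDl.
Qed.
HB.instance Definition _ :=
  GRing.isLinear.Build _ _ _ _ bracket_of_wedge bracket_of_wedge_linear.

Lemma bracket_of_wedgeE l l' : bracket_of_wedge (wedge C l l') = u (lie l l').
Proof.
rewrite (coords_lie C l l').
rewrite (@sum_alternating _ _ _ _ _ (fun i j => lie (X i) (X j))).
- rewrite linear_sum; apply: eq_bigr => t _.
  by rewrite linearZ ffunE.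
- by move=> i; rewrite liexx.
- by move=> i j; rewrite lieC.
Qed.

(** The values form a subspace that contains the coordinates of all brackets, and brackets span
    L^2. *)
Lemma bracket_of_wedge_surj w : exists a, bracket_of_wedge a = w.
Proof.
pose l := \sum_k w 0 k *: Y k.
have vl : v l = 0.
  by rewrite linear_sum big1 // => k _; rewrite linearZ /= cvY scaler0.
have <- : u l = w.
  rewrite linear_sum [RHS]row_sum_delta.
  by apply: eq_bigr => k _; rewrite linearZ /= cuY.
apply: (derived_ind (W := [set x | exists a, bracket_of_wedge a = u x])) (cv0_derived vl).
  split=> [|k x y /= [a ea] [b eb]] /=; first by exists 0; rewrite !linear0.
  by exists (k *: a + b); rewrite !linearP /= ea eb.
by move=> x y; exists (wedge C x y); rewrite bracket_of_wedgeE.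
Qed.

Definition lift_basis (b : L) : F := sval (cid (pres_map_surj P b)).

Lemma lift_basisK b : p (lift_basis b) = b.
Proof. by rewrite /lift_basis; case: cid. Qed.

(** Choosing preimages of basis vectors only gives a linear section of [p]. *)
Definition pres_lift (l : L) : F :=
  \sum_i v l 0 i *: lift_basis (X i) + \sum_k u l 0 k *: lift_basis (Y k).

Lemma pres_liftK l : p (pres_lift l) = l.
Proof.
rewrite [RHS](coordsE C) linearD !linear_sum; congr (_ + _).
  by apply: eq_bigr => i _; rewrite linearZ /= lift_basisK.
by apply: eq_bigr => i _; rewrite linearZ /= lift_basisK.
Qed.

Fact pres_lift_linear : linear pres_lift.
Proof.
move=> a x y; rewrite /pres_lift scalerDr addrACA; congr (_ + _).
  rewrite scaler_sumr -big_split; apply: eq_bigr => i _.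
  by rewrite linearP !mxE scalerDl scalerA.
rewrite scaler_sumr -big_split; apply: eq_bigr => i _.
by rewrite linearP !mxE scalerDl scalerA.
Qed.
HB.instance Definition _ := GRing.isLinear.Build _ _ _ _ pres_lift pres_lift_linear.

Definition eqRF (x y : F) := RF (x - y).

Lemma RF_subspace : subspace RF.
Proof. exact: lspan_subspace. Qed.

Lemma RF_lier x y : p x = 0 -> RF (lie x y).
Proof. by move=> px; apply: lie_prodP. Qed.

Lemma RF_liel x y : p x = 0 -> RF (lie y x).
Proof. by move=> px; rewrite lieC; apply: subspaceN RF_subspace _; apply: RF_lier. Qed.

Lemma RF_relations x : RF x -> p x = 0.
Proof.
apply: (lspan_ind (subspace_ker p)) => _ [r pr [y _ <-]] /=.
by rewrite pres_mapM [p r]pr lie0l.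
Qed.

Lemma RF_derived x : RF x -> derived F x.
Proof.
apply: (lspan_ind (derived_subspace _)) => _ [r pr [y _ <-]].
exact: derivedP.
Qed.

Lemma eqRF_trans y x z : eqRF x y -> eqRF y z -> eqRF x z.
Proof.
move=> xy yz; have := subspaceD RF_subspace xy yz.
by rewrite addrA subrK.
Qed.

Lemma eqRF_refl x : eqRF x x.
Proof. by rewrite /eqRF subrr; apply: subspace0 RF_subspace. Qed.

Lemma eqRF_sym x y : eqRF x y -> eqRF y x.
Proof. by move=> xy; rewrite /eqRF -opprB; apply: subspaceN RF_subspace xy. Qed.

Lemma eqRF_RF x y : eqRF x y -> RF y -> RF x.
Proof. by move=> xy Ry; rewrite -[x](subrK y); apply: subspaceD RF_subspace xy Ry. Qed.

Lemma eqRF_D x y x' y' : eqRF x y -> eqRF x' y' -> eqRF (x + x') (y + y').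
Proof.
move=> xy xy'; rewrite /eqRF opprD addrACA.
exact: subspaceD RF_subspace xy xy'.
Qed.

Lemma eqRF_Z a x y : eqRF x y -> eqRF (a *: x) (a *: y).
Proof. by move=> xy; rewrite /eqRF -scalerBr; apply: subspaceZ RF_subspace xy. Qed.

(** Changing a factor by a relation changes the bracket by an element of [R, F]: the quotient of F
    by [R, F] is a central extension of [L]. *)
Lemma eqRF_lie x x' y y' : p x = p x' -> p y = p y' -> eqRF (lie x y) (lie x' y').
Proof.
move=> xx' yy'; apply: (@eqRF_trans (lie x' y)); rewrite /eqRF.
  by rewrite -lieNl -lieDl; apply: RF_lier; rewrite linearB xx' subrr.
by rewrite -lieNr -lieDr; apply: RF_liel; rewrite linearB yy' subrr.
Qed.

(* [F^2, F^2] is contained in [R, F]: by Jacobi it lies in [F, [F, F^2]], and *)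
(* [F, F^2] consists of relations as L has class two. *)
Lemma RF_derived_derived x y : v (p x) = 0 -> v (p y) = 0 -> RF (lie x y).
Proof.
move=> vx /cv0_derived vy.
rewrite -[y](subrK (pres_lift (p y))) lieDr; apply: (subspaceD RF_subspace).
  by apply: RF_liel; rewrite linearB /= pres_liftK subrr.
move: (p y) vy => {y}.
apply: (derived_ind (W := [set l | RF (lie x (pres_lift l))])) => [|a b] /=.
  split=> [|k s t /= sR tR]; first by rewrite /= linear0 lie0r; apply: subspace0 RF_subspace.
  rewrite linearP /= lieDr lieZr.
  by apply: subspaceD RF_subspace _ tR; apply: subspaceZ RF_subspace sR.
have vp z : v (p (lie z x)) = 0 by rewrite pres_mapM cv_lie.
have pr c : p (lie c x) = 0 by rewrite pres_mapM (lie_cv0r (C := C)).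
have rp c : p (lie x c) = 0 by rewrite pres_mapM (lie_cv0 (c := C)).
have : eqRF (lie x (pres_lift (lie a b))) (lie x (lie (pres_lift a) (pres_lift b))).
  by apply: eqRF_lie; rewrite ?pres_mapM ?pres_liftK.
move/eqRF_RF; apply.
have := lie_jacobi x (pres_lift a) (pres_lift b); rewrite -addrA => /eqP.
rewrite addr_eq0 => /eqP->; apply: subspaceN RF_subspace _.
by apply: subspaceD RF_subspace _ _; apply: RF_liel.
Qed.

(** This is the inverse, modulo [R, F], of the map on F^2 induced by the cover cocycle;
    [unwedge_cover] and [cover_unwedge] compute the two composites. *)
Definition unwedge (w : W) : F :=
  \sum_(t : pairs d) (w.1 t : K) *: lie (pres_lift (X (val t).1)) (pres_lift (X (val t).2))
  + \sum_i \sum_k (w.2 i k : K) *: lie (pres_lift (X i)) (pres_lift (Y k)).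

Fact unwedge_linear : linear unwedge.
Proof.
move=> a x y; rewrite /unwedge scalerDr addrACA; congr (_ + _).
  rewrite scaler_sumr -big_split; apply: eq_bigr => i _.
  by rewrite /= !ffunE scalerDl scalerA.
rewrite scaler_sumr -big_split; apply: eq_bigr => i _.
rewrite scaler_sumr -big_split; apply: eq_bigr => k _.
by rewrite !mxE scalerDl scalerA.
Qed.
HB.instance Definition _ := GRing.isLinear.Build _ _ _ _ unwedge unwedge_linear.

Lemma unwedge_derived w : derived F (unwedge w).
Proof.
have sF := derived_subspace F.
apply: (subspaceD sF); apply: (subspace_sum sF) => i _.
  by apply: (subspaceZ sF); apply: derivedP.
by apply: (subspace_sum sF) => k _; apply: (subspaceZ sF); apply: derivedP.
Qed.

Definition lift_cY l : F := \sum_k u l 0 k *: pres_lift (Y k).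

Lemma unwedge_mx l l' :
  unwedge (0, (v l)^T *m u l') = lie (\sum_i v l 0 i *: pres_lift (X i)) (lift_cY l').
Proof.
rewrite /unwedge big1 => [|t _]; last by rewrite ffunE scale0r.
rewrite add0r lie_suml; apply: eq_bigr => i _.
rewrite lieZl lie_sumr scaler_sumr; apply: eq_bigr => k _.
by rewrite !mxE big_ord1 mxE lieZr scalerA.
Qed.

Lemma pres_lift_split l : pres_lift l = \sum_i v l 0 i *: pres_lift (X i) + lift_cY l.
Proof.
rewrite {1}(coordsE C l) linearD !linear_sum.
by congr (_ + _); apply: eq_bigr => i _; rewrite linearZ.
Qed.

Lemma v_lift_cY l : v (p (lift_cY l)) = 0.
Proof.
by rewrite !linear_sum big1 // => k _; rewrite !linearZ /= pres_liftK cvY scaler0.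
Qed.

(** The lift of [l] differs from a combination of the [pres_lift (X i)] by a lift of an element of
    L^2. Its bracket with the lift of [l'], also over L^2, lies in [R, F]. *)
Lemma unwedge_mxE l l' : v l' = 0 ->
  eqRF (unwedge (0, (v l)^T *m u l')) (lie (pres_lift l) (pres_lift l')).
Proof.
move=> vl'; rewrite unwedge_mx (pres_lift_split l) (pres_lift_split l').
rewrite [X in lie _ (X + _)]big1 ?add0r => [|i _]; last by rewrite vl' mxE scale0r.
rewrite lieDl -[X in eqRF X _]addr0; apply: eqRF_D; first exact: eqRF_refl.
apply: eqRF_sym; rewrite /eqRF subr0.
by apply: RF_derived_derived; apply: v_lift_cY.
Qed.

(** Modulo [R, F] the three tensors become the three double brackets of lifts, whose sum is zero by
    the Jacobi identity in F. *)
Lemma unwedge_jacobi_mx l1 l2 l3 : RF (unwedge (0, jacobi_mx C l1 l2 l3)).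
Proof.
have eqJ l l' l'' : eqRF (unwedge (0, (v l)^T *m u (lie l' l'')))
    (lie (pres_lift l) (lie (pres_lift l') (pres_lift l''))).
  apply: eqRF_trans (unwedge_mxE _ (cv_lie _ _ _)) _.
  by apply: eqRF_lie; rewrite ?pres_mapM ?pres_liftK.
apply: (@eqRF_RF _ (lie (pres_lift l1) (lie (pres_lift l2) (pres_lift l3))
  + lie (pres_lift l2) (lie (pres_lift l3) (pres_lift l1))
  + lie (pres_lift l3) (lie (pres_lift l1) (pres_lift l2)))); last first.
  by rewrite lie_jacobi; apply: subspace0 RF_subspace.
have -> : (0, jacobi_mx C l1 l2 l3) = (0, (v l1)^T *m u (lie l2 l3)) +
    (0, (v l2)^T *m u (lie l3 l1)) + (0, (v l3)^T *m u (lie l1 l2)) :> W.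
  by congr (_, _); rewrite /= !addr0.
rewrite !linearD /=; exact: (eqRF_D (eqRF_D (eqJ _ _ _) (eqJ _ _ _)) (eqJ _ _ _)).
Qed.

Lemma unwedge_jacobi g : g \in jacobi_space C -> RF (unwedge (0, g)).
Proof.
apply: (span_ind (Q := [set g | RF (unwedge (0, g))])) => [|_ /mapP[q _ ->]] /=.
  split=> [|a x y /= xR yR] /=.
    by rewrite -[(0, 0)]/(0 : W) linear0; apply: subspace0 RF_subspace.
  have -> : (0, a *: x + y) = a *: (0, x) + (0, y) :> W.
    by congr (_, _); rewrite /= scaler0 addr0.
  rewrite linearP /=; apply: subspaceD RF_subspace _ yR.
  exact: subspaceZ RF_subspace xR.
exact: unwedge_jacobi_mx.
Qed.

Lemma unwedge_wedge l l' : unwedge (wedge C l l', 0) =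
  lie (\sum_i v l 0 i *: pres_lift (X i)) (\sum_i v l' 0 i *: pres_lift (X i)).
Proof.
rewrite /unwedge [X in _ + X]big1 ?addr0 => [|i _]; last first.
  by rewrite big1 // => k _; rewrite mxE scale0r.
rewrite lie_suml; under [RHS]eq_bigr => i _.
  rewrite lieZl lie_sumr scaler_sumr.
  under eq_bigr => j _ do rewrite lieZr scalerA.
  over.
rewrite (@sum_alternating _ _ _ _ _ (fun i j => lie (pres_lift (X i)) (pres_lift (X j)))).
- by apply: eq_bigr => t _; rewrite ffunE.
- by move=> i; rewrite liexx.
- by move=> i j; rewrite lieC.
Qed.

(** Split both lifts into their [X] and [Y] parts. The [X] parts give the wedge, the mixed products
    give the cross terms, and the bracket of the [Y] parts lies in [R, F], as does the image of the
    projection that [jacobi_coset] subtracts. *)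
Lemma unwedge_cover x y : eqRF (lie x y) (unwedge (cover_fun C (p x) (p y))).
Proof.
set l := p x; set l' := p y.
apply: (@eqRF_trans (lie (pres_lift l) (pres_lift l'))).
  by apply: eqRF_lie; rewrite pres_liftK.
have -> : cover_fun C l l' = (wedge C l l', 0) + (0, (v l)^T *m u l')
    - (0, (v l')^T *m u l) - (0, projv (jacobi_space C) (cross_mx C l l')) :> W.
  by congr (_, _); rewrite /= ?subr0 ?addr0 ?add0r.
have Rproj := unwedge_jacobi (memv_proj (jacobi_space C) (cross_mx C l l')).
rewrite linearB /= -[lie _ _]subr0; apply: eqRF_D; last first.
  by rewrite /eqRF oppr0 opprK add0r.
rewrite linearB linearD /= unwedge_wedge !unwedge_mx (pres_lift_split l) (pres_lift_split l').
rewrite lieDl !lieDr; apply: eqRF_D; first exact: eqRF_refl.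
rewrite -[X in eqRF _ X]addr0 -lieC; apply: eqRF_D; first exact: eqRF_refl.
by rewrite /eqRF subr0; apply: RF_derived_derived; apply: v_lift_cY.
Qed.

Lemma wedge_XX (t : pairs d) : wedge C (X (val t).1) (X (val t).2) = [ffun s => (s == t)%:R].
Proof.
apply/ffunP => s; rewrite !ffunE !cvX !mxE eqxx /= -!natrM !mulnb.
have -> : ((val s).2 == (val t).1) && ((val s).1 == (val t).2) = false.
  apply/negP => /andP[/eqP e1 /eqP e2].
  have lts : ((val s).1 < (val s).2)%N := valP s.
  have ltt : ((val t).1 < (val t).2)%N := valP t.
  by move: ltt; rewrite -e1 -e2 ltnNge ltnW.
by rewrite subr0; congr ((nat_of_bool _)%:R); rewrite -[RHS]val_eqE.
Qed.

(** On basis elements [unwedge] gives brackets of lifts, where [t] is the cocycle; linearity does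
    the rest. *)
Lemma cover_unwedge (t : {linear F -> W}) w :
  (forall x y, t (lie x y) = cover_fun C (p x) (p y)) ->
  t (unwedge w) = (w.1, jacobi_coset C w.2).
Proof.
case: w => a g tE; rewrite linearD !linear_sum /=.
have -> : (a, jacobi_coset C g) = (a, 0) + (0, jacobi_coset C g) :> W.
  by congr (_, _); rewrite /= ?addr0 ?add0r.
congr (_ + _).
  under eq_bigr => s _.
    rewrite linearZ tE !pres_liftK /cover_fun /cross_mx !cuX !mulmx0 subrr linear0 wedge_XX.
    over.
  apply: injective_projections; rewrite ?(linear_sum fst) ?(linear_sum snd) /=.
    apply/ffunP => r; rewrite sum_ffunE (bigD1 r) //= big1 => [|s /negPf sr].
      by rewrite !ffunE eqxx addr0 /GRing.scale /= mulr1.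
    by rewrite !ffunE eq_sym sr scaler0.
  by rewrite big1 // => s _; rewrite scaler0.
have -> : (0, jacobi_coset C g) =
    \sum_i \sum_k g i k *: (0, jacobi_coset C (delta_mx i k)) :> W.
  rewrite {1}[g]matrix_sum_delta; apply: injective_projections.
    rewrite [RHS](linear_sum fst) [RHS]big1 // => i _.
    rewrite [LHS](linear_sum fst) big1 // => k _.
    exact: scaler0.
  rewrite [RHS](linear_sum snd) linear_sum; apply: eq_bigr => i _.
  rewrite [RHS](linear_sum snd) linear_sum; apply: eq_bigr => k _.
  exact: linearZ.
apply: eq_bigr => i _; rewrite linear_sum; apply: eq_bigr => k _.
rewrite linearZ tE !pres_liftK /=; congr (_ *: (_, jacobi_coset C _)).
  by apply/ffunP => s; rewrite !ffunE !cvY !mxE; ring.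
rewrite /cross_mx cvX cvY cuY trmx0 mul0mx subr0 trmx_delta mul_delta_mx.
by [].
Qed.

(** The kernel is the model of the multiplier: the first component is the map to L^2, and vanishing
    of the second cuts out the complement of [jacobi_space] where the cocycle takes its values. *)
Definition cover_relations (w : W) : 'rV[K]_m * subvs_of (jacobi_space C) :=
  (bracket_of_wedge w.1, vsproj (jacobi_space C) w.2).

Fact cover_relations_linear : linear cover_relations.
Proof. by move=> a x y; congr (_, _); rewrite /= linearP. Qed.
HB.instance Definition _ :=
  GRing.isLinear.Build _ _ _ _ cover_relations cover_relations_linear.

(** Rank-nullity for a surjective map: both [bracket_of_wedge] and the projection to [jacobi_space]
    are onto. *)
Lemma dim_cover_relations :
  (\dim (lker (linfun cover_relations)) + m + \dim (jacobi_space C)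
    = 'C(d, 2) + d * m)%N.
Proof.
have := limg_ker_dim (linfun cover_relations) fullv.
rewrite capfv.
have -> : limg (linfun cover_relations) = fullv.
  apply/vspaceP => -[w g]; rewrite memvf; apply/memv_imgP.
  have [a aw] := bracket_of_wedge_surj w.
  exists (a, vsval g); rewrite ?memvf // lfunE /=.
  by rewrite /cover_relations aw vsvalK.
rewrite !dimvf -[dim (_ * subvs_of _)%type]/(1 * m + \dim (jacobi_space C))%N.
rewrite -[dim W]/(#|{: pairs d}| * 1 + d * m)%N card_pairs mul1n muln1 => <-.
by rewrite addnA.
Qed.

Lemma vsproj_eq0 (V : vectType K) (U : {vspace V}) x : (vsproj U x == 0) = (projv U x == 0).
Proof. by rewrite -val_eqE /= unlock. Qed.

(** A linear map [t] trivialising the cover cocycle on F has kernel [R, F] on F^2, and maps the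
    relations in F^2 onto the kernel of [cover_relations]. *)
Lemma dim_schur_coords k : dim_schur_multiplier P k <->
  (k + m + \dim (jacobi_space C) = 'C(d, 2) + d * m)%N.
Proof.
have [t tE] := free_cocycle_trivial (cover_cocycle C) (@pres_freeP _ _ P) (@pres_mapM _ _ P).
have {}tE x y : t (lie x y) = cover_fun C (p x) (p y) by rewrite tE.
pose U := lker (linfun cover_relations).
have tU x : derived F x -> eqRF x (unwedge (t x)).
  apply: (derived_ind (W := [set x | eqRF x (unwedge (t x))])) => [|a b] /=.
    split=> [|a y z /= eqy eqz]; first by rewrite /= !linear0; apply: eqRF_refl.
    by rewrite !linearP; apply: eqRF_D eqz; apply: eqRF_Z.
  by rewrite tE; apply: unwedge_cover.
have pt x : derived F x -> u (p x) = bracket_of_wedge (t x).1.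
  apply: (derived_ind (W := [set x | u (p x) = bracket_of_wedge (t x).1])) => [|a b] /=.
    split=> [|a y z /= eqy eqz]; first by rewrite /= !linear0.
    by rewrite !linearP /= eqy eqz.
  by rewrite tE pres_mapM bracket_of_wedgeE.
have tproj x : derived F x -> vsproj (jacobi_space C) (t x).2 = 0.
  apply: (derived_ind (W := [set x | vsproj (jacobi_space C) (t x).2 = 0])) => [|a b] /=.
    split=> [|a y z /= eqy eqz]; first by rewrite /= !linear0.
    by rewrite !linearP /= eqy eqz scaler0 addr0.
  by apply/eqP; rewrite tE vsproj_eq0 /= linearB /= projv_proj subrr.
have vp x : derived F x -> v (p x) = 0.
  apply: (derived_ind (W := [set x | v (p x) = 0])) => [|a b] /=.
    exact: (subspace_ker (v \o p)).
  by rewrite pres_mapM cv_lie.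
have tRF x : RF x -> t x = 0.
  apply: (lspan_ind (subspace_ker t)) => _ [r pr [y _ <-]] /=.
  rewrite tE [p r]pr; congr (_, _).
    by apply/ffunP => s; rewrite !ffunE linear0 !mxE; ring.
  by rewrite /cross_mx !linear0 mul0mx addr0 linear0.
(* On F^2 both [v (p x)] and the projection of [t x] to [jacobi_space] vanish, so either side says
   that [u (p x)] is zero. *)
have p0 x : derived F x -> p x = 0 <-> t x \in U.
  move=> dx; rewrite memv_ker lfunE /= /cover_relations tproj // -pt //.
  split=> [->|/eqP[ux]]; first by rewrite linear0.
  rewrite [LHS](coordsE C) ux vp // !big1 ?addr0 // => i _; by rewrite mxE scale0r.
rewrite /dim_schur_multiplier (dim_quotient_image (f := t) (U := U)).
- rewrite -dim_cover_relations -/U; split=> [->//|]. 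
  by rewrite -!addnA => /addIn.
- by move=> x [px dx]; apply/p0.
(* As [w] has no component along [jacobi_space], it is its own coset representative, so [unwedge w]
   is a preimage. *)
- move=> w wU; have tUw : t (unwedge w) = w.
    rewrite (cover_unwedge _ tE); case: w wU => a g.
    rewrite memv_ker lfunE /= => /eqP[_ /eqP]; rewrite vsproj_eq0 => /eqP g0.
    by congr (_, _); rewrite /jacobi_coset g0 subr0.
  exists (unwedge w).
    split; last exact: unwedge_derived.
    by apply/p0; rewrite ?tUw //; apply: unwedge_derived.
  exact: tUw.
- by apply: subspaceI (subspace_ker p) (derived_subspace F).
- move=> x [px dx]; split=> [Rx|tx].
    exact: tRF.
  by apply: eqRF_RF (tU x dx) _; rewrite tx linear0; apply: subspace0 RF_subspace.
- by move=> x Rx; split; [apply: RF_relations|apply: RF_derived].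
Qed.

End MultiplierDimension.

(** * The Jacobi space *)

Section JacobiRank.
Variables (K : fieldType) (L : lieAlgType K) (d m : nat) (C : coords L d m).
Local Notation X := (cX C).
Local Notation Y := (cY C).
Local Notation v := (cv C).
Local Notation u := (cu C).
Local Notation J := (jacobi_mx C).
Local Notation r := (\dim (jacobi_space C)).

Lemma coords_has_dim k : has_dim (derived L) k <-> k = m.
Proof.
rewrite /has_dim (dim_quotient_image (f := u) (U := fullv)) ?dimvf.
- by rewrite /dim /= mul1n.
- by move=> *; rewrite memvf.
- move=> w _; exists (\sum_k w 0 k *: Y k).
    apply: (cv0_derived (c := C)).
    by rewrite linear_sum big1 // => i _; rewrite linearZ /= cvY scaler0.
  rewrite linear_sum [RHS]row_sum_delta.
  by apply: eq_bigr => i _; rewrite linearZ /= cuY.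
- exact: derived_subspace.
- move=> x dx /=; split=> [->|ux]; first exact: linear0.
  rewrite (coordsE C x) ux (cv_derived C dx).
  by rewrite !big1 ?addr0 // => i _; rewrite mxE scale0r.
- by move=> x ->; apply: subspace0 (derived_subspace L).
Qed.

Lemma cu_eq0 x : derived L x -> u x = 0 -> x = 0.
Proof.
move=> dx ux; rewrite (coordsE C x) ux (cv_derived C dx).
by rewrite !big1 ?addr0 // => i _; rewrite mxE scale0r.
Qed.

Lemma noncommuting_cX : derived L <> [set 0] ->
  exists i j, i != j /\ lie (X i) (X j) <> 0.
Proof.
move=> L2; have [//|all0] := EM (exists i j, i != j /\ lie (X i) (X j) <> 0).
case: L2; apply/seteqP; split=> [x|x ->]; last exact: subspace0 (derived_subspace L).
apply: derived_ind => [|a b] /=.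
  by split=> [//|k y z /= -> ->]; rewrite scaler0 addr0.
rewrite (coords_lie C) big1 // => i _; rewrite big1 // => j _.
have [->|ij] := eqVneq i j; first by rewrite liexx scaler0.
have [->|Xij] := EM (lie (X i) (X j) = 0); first exact: scaler0.
by case: all0; exists i, j.
Qed.

Section Rank.
Variables (i0 j0 : 'I_d).
Hypotheses (ij0 : i0 != j0) (lie0 : lie (X i0) (X j0) <> 0).
Local Notation x := (X i0).
Local Notation y := (X j0).
Local Notation z := (lie x y).

(** The tensors with first factor [x] or [y] fill only the rows [i0] and [j0]; every other row sees
    l (x) [x, y] alone. *)
Lemma row_jacobi_mx k l : k != i0 -> k != j0 -> row k (J x y l) = v l 0 k *: u z.
Proof.
move=> /negPf ki /negPf kj; rewrite /jacobi_mx !cvX !linearD /= !row_mul.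
have row0 i : k != i -> row k (delta_mx 0 i)^T = 0 :> 'rV[K]_1.
  by move=> /negPf ki'; apply/rowP => j; rewrite !mxE ki' andbF.
rewrite !row0 ?ki ?kj // !mul0mx !add0r; apply/rowP => j.
by rewrite !mxE big_ord1 !mxE.
Qed.

Definition others : seq 'I_d := enum (~: [set i0; j0]).

Lemma mem_others k : (k \in others) = (k != i0) && (k != j0).
Proof. by rewrite mem_enum !inE negb_or. Qed.

Lemma size_others : (2 + size others)%N = d.
Proof. by rewrite -cardE -[RHS]card_ord -(cardsC [set i0; j0]) cards2 ij0. Qed.

Definition jacobi_xy (a : 'rV[K]_d) : 'M[K]_(d, m) := J x y (\sum_k a 0 k *: X k).

Lemma jacobi_xyE a : jacobi_xy a = \sum_k a 0 k *: J x y (X k).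
Proof.
rewrite /jacobi_xy -jacobi_mx_cycle jacobi_mx_expand.
apply: eq_bigr => k _; rewrite jacobi_mx_cycle; congr (_ *: _).
rewrite linear_sum /= summxE (bigD1 k) //= linearZ /= cvX !mxE !eqxx mulr1.
by rewrite big1 ?addr0 // => i /negPf ik; rewrite linearZ /= cvX !mxE eq_sym ik mulr0.
Qed.

Fact jacobi_xy_linear : linear jacobi_xy.
Proof.
move=> a b c; rewrite !jacobi_xyE scaler_sumr -big_split; apply: eq_bigr => k _.
by rewrite !mxE scalerDl scalerA.
Qed.
HB.instance Definition _ := GRing.isLinear.Build _ _ _ _ jacobi_xy jacobi_xy_linear.

Lemma uz_neq0 : u z != 0.
Proof. by apply/eqP => /cu_eq0-/(_ (derivedP _ _)). Qed.

(** By the row formula an element of the kernel has zero coordinates off [i0] and [j0], so the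
    kernel has dimension at most 2. *)
Lemma dim_jacobi_xy : (d <= \dim (limg (linfun jacobi_xy)) + 2)%N.
Proof.
have := limg_ker_dim (linfun jacobi_xy) fullv.
rewrite capfv dimvf /dim /= mul1n => e; rewrite -[leqLHS]e addnC leq_add2l.
pose s := [:: delta_mx 0 i0; delta_mx 0 j0] : seq 'rV[K]_d.
apply: leq_trans (dim_span s); apply/dimvS/subvP => a.
rewrite memv_ker lfunE /= => /eqP a0.
rewrite [a]row_sum_delta; apply: memv_suml => k _.
have [->|ki] := eqVneq k i0; first by rewrite memvZ // memv_span ?inE ?eqxx.
have [->|kj] := eqVneq k j0; first by rewrite memvZ // memv_span ?inE ?eqxx ?orbT.
have := row_jacobi_mx (\sum_k a 0 k *: X k) ki kj; rewrite -/(jacobi_xy a) a0 linear0.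
move=> /esym/eqP; rewrite scaler_eq0 (negPf uz_neq0) orbF => /eqP.
rewrite linear_sum summxE (bigD1 k) //= linearZ /= cvX !mxE !eqxx mulr1.
rewrite big1 ?addr0 => [->|i /negPf ik]; first by rewrite scale0r mem0v.
by rewrite linearZ /= cvX !mxE eq_sym ik mulr0.
Qed.

Lemma limg_jacobi_xy : (limg (linfun jacobi_xy) <= jacobi_space C)%VS.
Proof.
apply/subvP => _ /memv_imgP[a _ ->]; rewrite lfunE /=.
exact: mem_jacobi_space.
Qed.

Lemma jacobi_rank_ge : (d <= r + 2)%N.
Proof.
by apply: leq_trans dim_jacobi_xy _; rewrite leq_add2r dimvS // limg_jacobi_xy.
Qed.

(** The J(x, y, l) form a space of dimension at least d - 2, so at the minimal rank they exhaust
    [jacobi_space]. *)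
Lemma jacobi_space_xy G : (r + 2)%N = d -> G \in jacobi_space C -> exists l, G = J x y l.
Proof.
move=> rd; suff /eqP<- : limg (linfun jacobi_xy) == jacobi_space C.
  by case/memv_imgP => a _ ->; rewrite lfunE; eexists.
rewrite eqEdim limg_jacobi_xy.
by rewrite -(leq_add2r 2) rd dim_jacobi_xy.
Qed.

Lemma jacobi_space_row k G : (r + 2)%N = d -> G \in jacobi_space C ->
  k != i0 -> k != j0 -> exists a, row k G = a *: u z.
Proof.
move=> rd /(jacobi_space_xy rd)[l ->] ki kj.
by exists (v l 0 k); apply: row_jacobi_mx.
Qed.

(** For G = J(x, y, l) the zero rows kill the coordinates of [l] off [i0] and [j0], as [z] is
    non-zero; moreover J(x, y, x) = J(x, y, y) = 0. *)
Lemma jacobi_space_rows_eq0 G : (r + 2)%N = d -> G \in jacobi_space C ->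
  (forall k, k != i0 -> k != j0 -> row k G = 0) -> G = 0.
Proof.
move=> rd /(jacobi_space_xy rd)[l ->] rows0.
rewrite -jacobi_mx_cycle jacobi_mx_expand big1 // => k _.
have [->|ki] := eqVneq k i0.
  by rewrite jacobi_mxxx scaler0.
have [->|kj] := eqVneq k j0; first by rewrite -jacobi_mx_cycle jacobi_mxxx scaler0.
have /eqP := rows0 k ki kj; rewrite row_jacobi_mx // scaler_eq0 (negPf uz_neq0) orbF.
by move/eqP->; rewrite scale0r.
Qed.

(** Every J of generators is a (x) z for a vector [a] without coordinates at [i0] and [j0], hence a
    combination of the d - 2 elements J(x, y, e). *)
Lemma heisenberg_rank :
  (forall l l', lie l l' = (v l 0 i0 * v l' 0 j0 - v l 0 j0 * v l' 0 i0) *: z) ->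
  (r + 2)%N = d.
Proof.
move=> lieE; apply/eqP; rewrite eqn_leq jacobi_rank_ge andbT.
pose s := [seq J x y (X k) | k <- others].
suff sub : (jacobi_space C <= <<s>>)%VS.
  rewrite (leq_trans (leq_add (leq_trans (dimvS sub) (dim_span s)) (leqnn 2))) //.
  by rewrite size_map addnC size_others.
apply: jacobi_space_sub => i j k; rewrite -/(J _ _ _).
pose det l l' := v l 0 i0 * v l' 0 j0 - v l 0 j0 * v l' 0 i0.
pose a : 'rV[K]_d := det (X j) (X k) *: v (X i) + det (X k) (X i) *: v (X j)
  + det (X i) (X j) *: v (X k).
have -> : J (X i) (X j) (X k) = a^T *m u z.
  rewrite /jacobi_mx (lieE (X j)) (lieE (X k)) (lieE (X i)) !linearD /= !linearZ /= !mulmxDl.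
  by rewrite -!scalemxAl.
(* Both coordinates are expansions of 3 by 3 determinants with two equal columns. *)
have ai0 : a 0 i0 = 0 by rewrite /a /det 5!mxE; ring.
have aj0 : a 0 j0 = 0 by rewrite /a /det 5!mxE; ring.
have -> : a^T *m u z = \sum_k a 0 k *: J x y (X k).
  rewrite {1}[a]row_sum_delta linear_sum mulmx_suml; apply: eq_bigr => l _.
  rewrite linearZ /= -scalemxAl; have [->|li] := eqVneq l i0; first by rewrite ai0 !scale0r.
  have [->|lj] := eqVneq l j0; first by rewrite aj0 !scale0r.
  congr (_ *: _); rewrite /jacobi_mx (lieE y (X l)) (lieE (X l) x) !cvX !mxE !eqxx.
  rewrite [i0 == l]eq_sym [j0 == l]eq_sym (negPf li) (negPf lj) /=.
  by rewrite ?(mul0r, mulr0, subr0, oppr0, scale0r, linear0, mulmx0, add0r).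
apply: memv_suml => l _; have [->|li] := eqVneq l i0; first by rewrite ai0 scale0r mem0v.
have [->|lj] := eqVneq l j0; first by rewrite aj0 scale0r mem0v.
by rewrite memvZ // memv_span //; apply/mapP; exists l; rewrite // mem_others li lj.
Qed.

End Rank.

Lemma jacobi_mxC l1 l2 l3 : J l2 l1 l3 = - J l1 l2 l3.
Proof.
rewrite /jacobi_mx (lieC l1 l2) (lieC l2 l3) (lieC l3 l1) !linearN /=.
by rewrite !opprD [X in X + _]addrC.
Qed.

End JacobiRank.

(** J is alternating, so on three generators each value is zero or, up to sign, the one at the three
    distinct generators. *)
Lemma jacobi_rank3 (K : fieldType) (L : lieAlgType K) m (C : coords L 3 m) :
  (\dim (jacobi_space C) <= 1)%N.
Proof.
pose J i j k := jacobi_mx C (cX C i) (cX C j) (cX C k).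
pose a : 'I_3 := ord0; pose b : 'I_3 := lift ord0 ord0; pose c : 'I_3 := ord_max.
suff sub : (jacobi_space C <= <[J a b c]>)%VS.
  by rewrite (leq_trans (dimvS sub)) // dim_vline; case: eqP.
apply: jacobi_space_sub.
have abc (i : 'I_3) : [\/ i = a, i = b | i = c].
  by case: i => [[|[|[|//]]] lt3]; [apply: Or31|apply: Or32|apply: Or33]; apply: val_inj.
have JC i j k : J j i k = - J i j k by apply: jacobi_mxC.
have Jcyc i j k : J i j k = J j k i by apply: jacobi_mx_cycle.
have J0 i j : J i i j = 0 by apply: jacobi_mxxx.
move=> i j k; rewrite -[jacobi_mx _ _ _ _]/(J i j k).
have J1 := memv_line (J a b c).
have [->|->|->] := abc i; have [->|->|->] := abc j; have [->|->|->] := abc k;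
  rewrite ?J0 ?mem0v //;
  by first [ exact: J1 | rewrite Jcyc ?J0 ?mem0v //; exact: J1
    | rewrite Jcyc Jcyc ?J0 ?mem0v //; exact: J1
    | rewrite JC memvN; exact: J1
    | rewrite Jcyc JC memvN; exact: J1
    | rewrite Jcyc Jcyc JC memvN; exact: J1].
Qed.

(** * Coordinates in finite dimension *)

(* As [passmx.rVof] and [passmx.vecof], but for a basis whose length is only *)
(* provably equal to the dimension. *)
Section BasisCoordinates.
Variables (K : fieldType) (V : vectType K) (k : nat) (b : k.-tuple V).

Definition row_coord x : 'rV[K]_k := \row_i coord b i x.
Definition row_comb (w : 'rV[K]_k) : V := \sum_i w 0 i *: b`_i.

Fact row_coord_linear : linear row_coord.
Proof. by move=> a x y; apply/rowP => i; rewrite !mxE linearP. Qed.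
HB.instance Definition _ := GRing.isLinear.Build _ _ _ _ row_coord row_coord_linear.

Fact row_comb_linear : linear row_comb.
Proof.
move=> a x y; rewrite scaler_sumr -big_split; apply: eq_bigr => i _.
by rewrite !mxE scalerDl scalerA.
Qed.
HB.instance Definition _ := GRing.isLinear.Build _ _ _ _ row_comb row_comb_linear.

Hypothesis bb : basis_of fullv b.

Lemma row_coordK : cancel row_coord row_comb.
Proof.
move=> x; rewrite [RHS](coord_basis bb) ?memvf //.
by apply: eq_bigr => i _; rewrite mxE.
Qed.

Lemma row_combK : cancel row_comb row_coord.
Proof. by move=> w; apply/rowP => i; rewrite mxE coord_sum_free ?(basis_free bb). Qed.

Lemma row_coord_nth i : row_coord b`_i = \row_j (i == j)%:R.
Proof.
(* Past the end of [b] the entry is the default 0, and no column has index [i]. *)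
have [ik|ki] := ltnP i k; last first.
  rewrite nth_default ?size_tuple // linear0; apply/rowP => j; rewrite !mxE.
  by rewrite gtn_eqF // (leq_trans (ltn_ord j)).
by apply/rowP => j; rewrite !mxE (coord_free (Ordinal ik) j) ?(basis_free bb).
Qed.

End BasisCoordinates.

Lemma linear_bij_dim (K : fieldType) (V W : vectType K) (f : {linear V -> W}) (g : W -> V) :
  cancel f g -> cancel g f -> \dim {: V} = \dim {: W}.
Proof.
move=> fK gK; have := limg_ker_dim (linfun f) fullv; rewrite capfv.
have /eqP-> : lker (linfun f) == 0%VS.
  by apply/lker0P => x y; rewrite !lfunE => /(can_inj fK).
suff -> : limg (linfun f) = fullv by rewrite dimv0 add0n.
apply/vspaceP => w; rewrite memvf; apply/memv_imgP.
by exists (g w); rewrite ?memvf // lfunE /= gK.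
Qed.

Section CoordsOfSplit.
Variables (K : fieldType) (L : lieAlgType K) (d m : nat).
Variables (phi : {linear L -> 'rV[K]_(d + m)}) (psi : {linear 'rV[K]_(d + m) -> L}).
Hypotheses (phiK : cancel phi psi) (psiK : cancel psi phi).
Hypothesis phi_lie : forall l l', lsubmx (phi (lie l l')) = 0.
Hypothesis lie_phi0 : forall l l', lsubmx (phi l) = 0 -> lie l l' = 0.
Hypothesis phi0_derived : forall l, lsubmx (phi l) = 0 -> derived L l.

(** The conclusion records [cv] and [cX], the data in which the Heisenberg rank computation is
    expressed. *)
Lemma coords_of_split : exists C : coords L d m, cv C =1 lsubmx \o phi /\
  forall i, cX C i = psi (delta_mx 0 (lshift m i)).
Proof.
pose X i := psi (delta_mx 0 (lshift m i)).
pose Y k := psi (delta_mx 0 (rshift d k)).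
pose v : {linear L -> 'rV[K]_d} := lsubmx \o phi.
pose u : {linear L -> 'rV[K]_m} := rsubmx \o phi.
have E l : l = \sum_i v l 0 i *: X i + \sum_k u l 0 k *: Y k.
  rewrite -{1}[l]phiK [phi l]row_sum_delta linear_sum big_split_ord /=.
  by congr (_ + _); apply: eq_bigr => i _; rewrite linearZ /= !mxE.
have vX i : v (X i) = delta_mx 0 i.
  by rewrite /= psiK; apply/rowP => j; rewrite !mxE eq_lshift.
have vY k : v (Y k) = 0.
  by rewrite /= psiK; apply/rowP => j; rewrite !mxE eq_lrshift.
have uX i : u (X i) = 0.
  by rewrite /= psiK; apply/rowP => j; rewrite !mxE eq_rlshift.
have uY k : u (Y k) = delta_mx 0 k.
  by rewrite /= psiK; apply/rowP => j; rewrite !mxE eq_rshift.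
by exists (Coords E vX vY uX uY phi_lie lie_phi0 phi0_derived).
Qed.

End CoordsOfSplit.

Lemma subspace_has_vspace (K : fieldType) (V : vectType K) (A : set V) k :
  subspace A -> has_dim A k -> exists2 D : {vspace V}, \dim D = k & forall x, x \in D <-> A x.
Proof.
move=> sA; move=> Ak; have [v [Av spanv _]] := Ak.
pose D := <<[seq v i | i : 'I_k]>>%VS.
have DA x : x \in D <-> A x.
  split=> [|/spanv[c /eqP]].
    by apply: (span_ind sA) => _ /mapP[i _ ->].
  rewrite subr_eq0 => /eqP->; apply: memv_suml => i _; rewrite memvZ //.
  by apply/memv_span/mapP; exists i; rewrite ?mem_enum.
exists D => //; apply/esym; move: Ak.
rewrite /has_dim (dim_quotient_image (f := idfun) (U := D)) //.
- by move=> x /DA.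
- by move=> x xD; exists x => //; apply/DA.
- by move=> x ->; apply: subspace0.
Qed.

Section FiniteDimensional.
Variables (K : fieldType) (L : finLieAlgType K).

Lemma exists_coords m : nilpotent_of_class L 2 -> has_dim (derived L) m ->
  exists d, exists C : coords L d m, True.
Proof.
move=> [L3 _] L2m.
have [D Dm DL2] := subspace_has_vspace (derived_subspace L) L2m.
exists (\dim D^C).
have sD : size (vbasis D) == m by rewrite size_tuple Dm.
(* The complement comes first, so that the left block of coordinates describes the class modulo
   L^2. *)
pose b := cat_tuple (vbasis D^C) (Tuple sD).
have bb : basis_of fullv b.
  rewrite basisEdim size_tuple span_cat /=.
  rewrite !(span_basis (vbasisP _)) addvC addv_complf subvf.
  by rewrite dimv_compl -Dm subnK // dimvS // subvf.
have phi0 l : lsubmx (row_coord b l) = 0 <-> l \in D.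
  split=> [l0|].
    rewrite -[l](row_coordK bb) /row_comb big_split_ord /=.
    rewrite big1 ?add0r => [|i _]; last first.
      by move/rowP/(_ i): l0; rewrite [LHS]mxE [RHS]mxE => ->; rewrite scale0r.
    apply: memv_suml => k _; rewrite memvZ // nth_cat size_tuple ltnNge leq_addr /=.
    by rewrite addKn vbasis_mem // mem_nth // size_tuple Dm.
  move/coord_vbasis->; rewrite !linear_sum big1 // => k _; rewrite !linearZ /=.
  have k' : (\dim D^C + k < \dim D^C + m)%N by rewrite ltn_add2l -Dm.
  have -> : (vbasis D)`_k = b`_(Ordinal k').
    by rewrite /= nth_cat size_tuple ltnNge leq_addr /= addKn.
  rewrite (row_coord_nth bb) (_ : lsubmx _ = 0) ?scaler0 //.
  apply/rowP => i; rewrite !mxE /= gtn_eqF //.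
  by rewrite (leq_trans (ltn_ord i)) ?leq_addr.
have [||l l'|l l' /phi0/DL2 dl|l /phi0/DL2//|C _] :=
    coords_of_split (phi := row_coord b) (psi := row_comb b).
- exact: row_coordK.
- exact: row_combK.
- by apply/phi0/DL2; apply: derivedP.
(* Here [l] lies in L^2, so the bracket lies in the third term of the lower central series, which is
   zero. *)
- have : lower_central 2 (lie l l') by apply: lie_prodP.
  by rewrite L3.
- by exists C.
Qed.

Variables (d m : nat) (C : coords L d m).

Local Notation X := (cX C).
Local Notation Y := (cY C).
Local Notation v := (cv C).
Local Notation u := (cu C).

Lemma cv_sumX (a : 'rV[K]_d) : v (\sum_i a 0 i *: X i) = a.
Proof.
rewrite linear_sum [RHS]row_sum_delta; apply: eq_bigr => i _.
by rewrite linearZ /= cvX.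
Qed.

Lemma coords_dim : \dim {: L} = (d + m)%N.
Proof.
pose f l : ('rV[K]_d * 'rV[K]_m)%type := (v l, u l).
have fL : linear f by move=> a x y; rewrite /f !linearP.
pose F : {linear L -> _} := HB.pack f (GRing.isLinear.Build _ _ _ _ f fL).
pose g (w : 'rV[K]_d * 'rV[K]_m) : L := \sum_i w.1 0 i *: X i + \sum_k w.2 0 k *: Y k.
have fK : cancel F g by move=> l; rewrite [RHS](coordsE C).
have gK : cancel g F.
  move=> [a c]; congr (_, _); rewrite linearD /=.
    rewrite cv_sumX linear_sum big1 ?addr0 // => k _.
    by rewrite linearZ /= cvY scaler0.
  rewrite linear_sum big1 ?add0r => [|i _]; last by rewrite linearZ /= cuX scaler0.
  rewrite linear_sum [RHS]row_sum_delta; apply: eq_bigr => k _.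
  by rewrite linearZ /= cuY.
by rewrite (linear_bij_dim fK gK) dimvf -[LHS]/(1 * d + 1 * m)%N !mul1n.
Qed.

Lemma derived_vspace : exists2 D : {vspace L}, \dim D = m & forall x, x \in D <-> derived L x.
Proof. by apply: subspace_has_vspace (derived_subspace L) _; apply/(coords_has_dim C). Qed.

Lemma coords_full (U : {vspace L}) :
  (forall i, X i \in U) -> (forall x, derived L x -> x \in U) -> (fullv <= U)%VS.
Proof.
move=> XU DU; apply/subvP => x _; rewrite (coordsE C x) memvD //.
  by apply: memv_suml => i _; rewrite memvZ.
apply: memv_suml => k _; rewrite memvZ // DU //.
exact: (cv0_derived (c := C) (cvY C k)).
Qed.

Lemma derived_sub (U : {vspace L}) :
  (forall i j, lie (X i) (X j) \in U) -> forall x, derived L x -> x \in U.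
Proof.
move=> XU; apply: derived_ind; first exact: (subspace_vspace U).
move=> x y /=; rewrite (coords_lie C); apply: memv_suml => i _.
by apply: memv_suml => j _; rewrite memvZ.
Qed.

End FiniteDimensional.

(** Brackets are alternating, so pairs [i < j] suffice. Natural-number indices allow case analysis
    on explicit bases. *)
Lemma lie_morphism_basis (K : fieldType) (L : finLieAlgType K) (M : lieAlgType K)
    (f : {linear L -> M}) k (b : k.-tuple L) : basis_of fullv b ->
  (forall i j : nat, (i < j < k)%N -> f (lie b`_i b`_j) = lie (f b`_i) (f b`_j)) ->
  lie_morphism f.
Proof.
move=> bb fb.
have {}fb (i j : 'I_k) : f (lie b`_i b`_j) = lie (f b`_i) (f b`_j).
  case: (ltngtP i j) => [ij|ji|->]; first by rewrite fb // ij ltn_ord.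
    by rewrite lieC linearN fb ?ji ?ltn_ord // [RHS]lieC.
  by rewrite !liexx linear0.
move=> x y; rewrite -[x](row_coordK bb) -[y](row_coordK bb) /row_comb.
rewrite lie_suml !linear_sum lie_suml; apply: eq_bigr => i _.
rewrite lie_sumr lie_sumr linear_sum; apply: eq_bigr => j _.
by rewrite lieZl lieZr !linearZ /= lieZl lieZr fb.
Qed.

(** * Classification *)

Definition table_coef (K : fieldType) (p : nat * nat * nat) (i j : nat) : K :=
  ((i == p.1.1) && (j == p.1.2))%:R - ((i == p.1.2) && (j == p.1.1))%:R.

(** As [row_coord b] sends [b] to the standard basis, a table algebra is recognised by the structure
    constants of a basis of [L]. *)
Lemma table_lie_basis (K : fieldType) (L : finLieAlgType K) n t (b : n.+1.-tuple L)
    (i j : nat) : basis_of fullv b -> central_table n t ->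
  lie b`_i b`_j = \sum_(p <- t) table_coef K p i j *: b`_p.2 ->
  row_coord b (lie b`_i b`_j) = table_lie t (row_coord b b`_i) (row_coord b b`_j).
Proof.
move=> bb /allP ct ->; rewrite linear_sum /table_lie big_seq [RHS]big_seq.
apply: eq_bigr => p pt; have /andP[p2n /allP/(_ p pt)/and4P[p11 p12 _ _]] := ct p pt.
rewrite linearZ /= !(row_coord_nth bb) !mxE !inordK ?ltnS //.
rewrite -!natrM !mulnb; congr (_ *: _); apply/rowP => k.
by rewrite !mxE eqxx /= -val_eqE /= inordK ?ltnS // eq_sym.
Qed.

Section Classification.
Variables (K : fieldType) (L : finLieAlgType K) (d m : nat) (C : coords L d m).
Local Notation X := (cX C).
Local Notation Y := (cY C).
Local Notation v := (cv C).
Local Notation u := (cu C).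

Lemma derived_free_span (s : seq L) : free s ->
  (forall x, x \in s -> derived L x) ->
  (forall i j, lie (X i) (X j) \in <<s>>%VS) ->
  m = size s.
Proof.
move=> frees sD XXs; have [D <- DP] := derived_vspace C.
suff -> : D = <<s>>%VS by apply/eqP.
apply/vspaceP => x; apply/idP/idP => [/DP|].
  exact: (derived_sub (C := C)).
by apply: (span_ind (Q := [set x | x \in D])); [exact: subspace_vspace|move=> y /sD/DP].
Qed.

(** The family spans, since the [X i] and L^2 do, and its length is the dimension d + m. *)
Lemma basis_cat_derived (h s : seq L) : free s ->
  (forall x, x \in s -> derived L x) ->
  (forall i j, lie (X i) (X j) \in <<s>>%VS) ->
  (forall i, X i \in <<h ++ s>>%VS) -> size h = d ->
  basis_of fullv (h ++ s).
Proof.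
move=> frees sD XXs Xh hd; rewrite basisEdim size_cat hd.
rewrite (coords_dim C) (derived_free_span frees sD XXs) leqnn andbT.
apply: (coords_full (C := C)) => // x /(derived_sub (C := C) XXs).
by rewrite span_cat; apply/subvP/addvSr.
Qed.

Lemma lie_lie0 x y l : lie (lie x y) l = 0 :> L.
Proof. by apply: (lie_cv0 (c := C)); apply: cv_lie. Qed.

Lemma lie_lie0r x y l : lie l (lie x y) = 0 :> L.
Proof. by rewrite lieC lie_lie0 oppr0. Qed.

Lemma isomorphic_L58_L626 (i j k : 'I_d) :
  d = 3 -> (forall l, [\/ l = i, l = j | l = k]) ->
  free [:: lie (X i) (X j); lie (X i) (X k)] ->
  lie_isomorphic L (lie_L58 K) \/ lie_isomorphic L (lie_L626 K).
Proof.
move=> d3 ijk; set z := lie _ _; set w := lie _ (X k) => freezw.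
set t := lie (X j) (X k).
have brackets (U : {vspace L}) : z \in U -> w \in U -> t \in U ->
    forall a b, lie (X a) (X b) \in U.
  move=> zU wU tU a b.
  by have [->|->|->] := ijk a; have [->|->|->] := ijk b; rewrite ?liexx ?mem0v //
    lieC memvN.
have [tzw|tzw] := boolP (t \in <<[:: z; w]>>%VS); [left|right].
  have [al [be tE]] : exists al be, t = al *: z + be *: w.
    move: tzw; rewrite span_cons span_seq1 => /memv_addP[_ /vlineP[al ->]].
    by case=> _ /vlineP[be ->] ->; exists al, be.
  (* Since [X j, X k] = al z + be w, these changes make [y, e] zero while keeping [x, y] = z and
     [x, e] = w. *)
  pose x := X i; pose y := X j - be *: x; pose e := X k + al *: x.
  pose b := [tuple x; y; e; z; w].
  have bb : basis_of fullv b.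
    apply: (basis_cat_derived (h := [:: x; y; e]) (s := [:: z; w])) => //.
    - by move=> l; rewrite !inE => /orP[]/eqP->; apply: derivedP.
    - by apply: brackets => //; apply: memv_span; rewrite !inE eqxx ?orbT.
    have xb : x \in <<b>>%VS by apply: memv_span; rewrite !inE eqxx.
    move=> l; have [->|->|->] := ijk l => //.
      rewrite -[X j](subrK (be *: x)) memvD ?memvZ //.
      by apply: memv_span; rewrite !inE eqxx ?orbT.
    rewrite -[X k](addrK (al *: x)) memvB ?memvZ //.
    by apply: memv_span; rewrite !inE eqxx ?orbT.
  exists (row_coord b); split; last first.
  by exists (row_comb b); [apply: row_coordK|apply: row_combK].
  apply: (lie_morphism_basis bb) => a c ac; apply: table_lie_basis => //.
  rewrite !big_cons big_nil /table_coef /=.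
  case: a c ac => [|[|[|[|[|a]]]]] [|[|[|[|[|c]]]]] //= _;
    rewrite ?subrr ?subr0 ?scale0r ?scale1r ?add0r ?addr0 /z /w ?lie_lie0r ?nth_nil ?lie0l //.
  - by rewrite /y lieDr lieNr lieZr liexx scaler0 oppr0 addr0.
  - by rewrite /e lieDr lieZr liexx scaler0 addr0.
  rewrite /y /e lieDl !lieDr !lieNl !lieZl !lieZr liexx !scaler0 ?oppr0 ?addr0.
  rewrite -/t tE (lieC x) -/z -/w scalerN.
  by rewrite [X in X + _]addrAC subrr add0r subrr.
pose b := [tuple X i; X j; X k; z; w; t].
have bb : basis_of fullv b.
  apply: (basis_cat_derived (h := [:: X i; X j; X k]) (s := [:: z; w; t])) => //.
  - have tP : perm_eq [:: z; w; t] [:: t; z; w] by rewrite (perm_catC [:: z; w] [:: t]).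
    by rewrite (perm_free tP) free_cons tzw.
  - by move=> l; rewrite !inE => /or3P[]/eqP->; apply: derivedP.
  - by apply: brackets => //; apply: memv_span; rewrite !inE eqxx ?orbT.
  by move=> l; apply: memv_span; have [->|->|->] := ijk l; rewrite !inE eqxx ?orbT.
exists (row_coord b); split; last first.
  by exists (row_comb b); [apply: row_coordK|apply: row_combK].
apply: (lie_morphism_basis bb) => a c ac; apply: table_lie_basis => //.
rewrite !big_cons big_nil /table_coef /=.
by case: a c ac => [|[|[|[|[|[|a]]]]]] [|[|[|[|[|[|c]]]]]] //= _;
    rewrite ?subrr ?subr0 ?scale0r ?scale1r ?add0r ?addr0 /z /w /t ?lie_lie0r ?nth_nil ?lie0l.
Qed.

Section Heisenberg.
Variables (i0 j0 : 'I_d) (ij0 : i0 != j0).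
Local Notation x := (X i0).
Local Notation y := (X j0).
Local Notation z := (lie x y).
Hypothesis z0 : z <> 0.

(** The [e k] commute with all generators, so [x], [y], [z] span a copy of H(1) and the [e k] an
    abelian complement. *)
Lemma isomorphic_heisenberg (p q : 'I_d -> K) (e : 'I_d -> L) :
  (forall k, X k = p k *: x + q k *: y + e k) ->
  (forall k, lie x (e k) = 0) -> (forall k, lie y (e k) = 0) ->
  (forall k l, lie (e k) (e l) = 0) -> e i0 = 0 -> e j0 = 0 ->
  lie_isomorphic L (heisenberg1 K * abelian_lie K (\dim {: L} - 3)%N)%type.
Proof.
move=> XE xe ye ee ei0 ej0.
pose h := [:: x, y & [seq e k | k <- others i0 j0]].
have freez : free [:: z] by rewrite seq1_free; apply/eqP.
have zD l : l \in [:: z] -> derived L l by rewrite inE => /eqP->; apply: derivedP.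
have brackets i j : lie (X i) (X j) \in <<[:: z]>>%VS.
  rewrite span_seq1 (XE i) (XE j) !lieDl !lieDr !lieZl !lieZr !liexx ee xe ye.
  rewrite (lieC x (e i)) (lieC y (e i)) xe ye (lieC x y).
  rewrite ?oppr0 ?scaler0 ?addr0 ?add0r.
  by rewrite memvD ?memvZ ?memvN ?memv_line.
have sh : size h = d by rewrite /= size_map -[RHS](size_others ij0).
have dimL : \dim {: L} = d.+1.
  by rewrite (coords_dim C) (derived_free_span freez zD brackets) addn1.
have xh : x \in <<h>>%VS by apply: memv_span; rewrite inE eqxx.
have yh : y \in <<h>>%VS by apply: memv_span; rewrite !inE eqxx orbT.
have hb : basis_of fullv (h ++ [:: z]).
  apply: basis_cat_derived => // i; rewrite span_cat.
  apply: (subvP (addvSl _ _)); rewrite (XE i).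
  rewrite !memvD ?memvZ //; have [->|ii] := eqVneq i i0; first by rewrite ei0 mem0v.
  have [->|ij] := eqVneq i j0; first by rewrite ej0 mem0v.
  apply: memv_span; rewrite !inE; apply/orP; right; apply/orP; right.
  by apply/mapP; exists i; rewrite // mem_others ii ij.
(* Moving [z] to third place makes the first three coordinates those of H(1). *)
pose s := [:: x, y, z & [seq e k | k <- others i0 j0]].
have sizes : size s == (3 + (\dim {: L} - 3))%N.
  by rewrite dimL -sh /= size_map !addSn add0n !subSS subn0.
pose b := Tuple sizes.
have bb : basis_of fullv b.
  rewrite (perm_basis (Y := h ++ [:: z])) //.
  rewrite /= !perm_cons -cat1s perm_catC.
  by [].
pose f l : (heisenberg1 K * abelian_lie K (\dim {: L} - 3)%N)%type :=
  (lsubmx (row_coord b l), rsubmx (row_coord b l)).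
have fL : linear f by move=> a l l'; rewrite /f !linearP.
pose F : {linear L -> _} := HB.pack f (GRing.isLinear.Build _ _ _ _ f fL).
exists F; split; last first.
  exists (fun w => row_comb b (row_mx w.1 w.2)) => [l|[w a]] /=.
    by rewrite hsubmxK row_coordK.
  by rewrite /f row_combK // row_mxKl row_mxKr.
(* Entries past the end are the default 0, which is [e i0], so every entry is some [e k]. *)
have es c : exists k, e k = [seq e k | k <- others i0 j0]`_c.
  have [lt|ge] := ltnP c (size (others i0 j0)).
    by exists (nth i0 (others i0 j0) c); rewrite (nth_map i0).
  by exists i0; rewrite ei0 nth_default // size_map.
apply: (lie_morphism_basis bb) => a c /andP[ac _].
have -> : lie b`_a b`_c = ((a == 0%N) && (c == 1%N))%:R *: z.
  case: a c ac => [|[|[|a]]] [|[|[|c]]] //= _;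
    rewrite ?scale0r ?scale1r ?lie_lie0 ?lie_lie0r //.
  - by have [k <-] := es c.
  - by have [k <-] := es c.
  by have [k <-] := es a; have [l <-] := es c.
rewrite linearZ /=.
have -> : z = b`_2 by [].
rewrite /f !(row_coord_nth bb).
congr (_, _); last first.
  by apply/rowP => k; rewrite !mxE /= mulr0.
rewrite /= -[RHS]/(table_lie table_H1 _ _) /table_lie big_cons big_nil addr0.
rewrite !mxE /= !inordK //.
rewrite -!natrM !mulnb [X in _ - X](_ : _ = 0) ?subr0; last first.
  by case: a c ac => [|[|a]] [|c].
congr (_ *: _); apply/rowP => k; rewrite !mxE /= -val_eqE /= inordK //.
by rewrite eq_sym.
Qed.

End Heisenberg.

Lemma isomorphic_heisenberg_of_rank (i0 j0 : 'I_d) : i0 != j0 ->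
  lie (X i0) (X j0) <> 0 -> (\dim (jacobi_space C) + 2)%N = d ->
  (forall k, exists a, lie (X i0) (X k) = a *: lie (X i0) (X j0)) ->
  (forall k, exists a, lie (X j0) (X k) = a *: lie (X i0) (X j0)) ->
  lie_isomorphic L (heisenberg1 K * abelian_lie K (\dim {: L} - 3)%N)%type.
Proof.
set x := X i0; set y := X j0; set z := lie x y.
move=> ij0 z0 rd /choice[a xX] /choice[c yX].
have yx : lie y x = - z by rewrite lieC.
have inj_z s t : s *: z = t *: z -> s = t.
  move/eqP; rewrite -subr_eq0 -scalerBl scaler_eq0 (introF eqP z0) orbF subr_eq0.
  by move/eqP.
have a0 : a i0 = 0 by apply: inj_z; rewrite -xX liexx scale0r.
have aj : a j0 = 1 by apply: inj_z; rewrite -xX scale1r.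
have c0 : c i0 = -1 by apply: inj_z; rewrite -yX yx scaleN1r.
have cj : c j0 = 0 by apply: inj_z; rewrite -yX liexx scale0r.
(* The coefficients of [x, X k] and [y, X k] are [a k] and [c k]; as [x, y] = z = - [y, x], the
   correction cancels both brackets. *)
pose e k := X k - a k *: y + c k *: x.
have xe k : lie x (e k) = 0.
  by rewrite /e !lieDr lieNr !lieZr liexx scaler0 addr0 xX -/z subrr.
have ye k : lie y (e k) = 0.
  by rewrite /e !lieDr lieNr !lieZr liexx scaler0 oppr0 addr0 yX yx scalerN subrr.
apply: (isomorphic_heisenberg ij0 z0 (p := fun k => - c k) (q := a) (e := e)) => //.
- by move=> k; rewrite /e scaleNr [RHS]addrC addrA addrK subrK.
(* The tensor J(x, e k, e l) = x (x) [e k, e l] lives in row [i0] alone. At the minimal rank a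
   member of [jacobi_space] without rows off [i0] and [j0] is zero, so the bracket vanishes. *)
- move=> k l; apply: (cu_eq0 (C := C)); first exact: derivedP.
  have Je : jacobi_mx C x (e k) (e l) = (delta_mx 0 i0)^T *m u (lie (e k) (e l)).
    by rewrite /jacobi_mx cvX xe (lieC x (e l)) xe oppr0 linear0 !mulmx0 !addr0.
  have J0 : jacobi_mx C x (e k) (e l) = 0.
    apply: (jacobi_space_rows_eq0 z0 rd (mem_jacobi_space C x (e k) (e l))) => n ni _.
    rewrite Je row_mul (_ : row n _ = 0) ?mul0mx //.
    by apply/rowP => s; rewrite !mxE (negPf ni) andbF.
  move: J0; rewrite Je => /(congr1 (row i0)); rewrite row_mul linear0.
  rewrite (_ : row i0 _ = 1%:M) ?mul1mx //.
  by apply/rowP => s; rewrite !mxE [s]ord1 !eqxx.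
- by rewrite /e a0 c0 scale0r subr0 scaleN1r subrr.
- by rewrite /e aj cj scale1r scale0r addr0 subrr.
Qed.

Lemma free_pair (V : vectType K) (z w : V) : z != 0 -> w \notin <[z]>%VS -> free [:: z; w].
Proof.
move=> z0 wz; have zwP : perm_eq [:: z; w] [:: w; z] by rewrite (perm_catC [:: z] [:: w]).
by rewrite (perm_free zwP) free_cons span_seq1 wz seq1_free.
Qed.

(* With four generators, some row of the Jacobi matrix of X i, X k, X l would *)
(* be [X i, X k]: the rank hypothesis forces it to be a multiple of [X i, X j]. *)
Lemma generators_le3 (i j k : 'I_d) : lie (X i) (X j) <> 0 ->
  (\dim (jacobi_space C) + 2)%N = d -> k != i -> k != j ->
  lie (X i) (X k) \notin <[lie (X i) (X j)]>%VS ->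
  forall l, [\/ l = i, l = j | l = k].
Proof.
move=> z0 rd ki kj wz l.
have [->|li] := eqVneq l i; first by apply: Or31.
have [->|lj] := eqVneq l j; first by apply: Or32.
have [->|lk] := eqVneq l k; first by apply: Or33.
case/negP: wz; apply/vlineP.
have [a ea] := jacobi_space_row z0 rd (mem_jacobi_space C (X i) (X k) (X l)) li lj.
exists a; apply/eqP; rewrite -subr_eq0; apply/eqP; apply: (cu_eq0 (C := C)).
  apply: (subspaceB (derived_subspace L)); first exact: derivedP.
  by apply: (subspaceZ (derived_subspace L)); apply: derivedP.
rewrite linearB linearZ /= -ea /jacobi_mx !cvX !linearD /= !row_mul.
have row0 s : l != s -> row l (delta_mx 0 s)^T = 0 :> 'rV[K]_1.
  by move=> /negPf ls; apply/rowP => t; rewrite !mxE ls andbF.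
rewrite (row0 i) // (row0 k) // !mul0mx oppr0 !add0r (_ : row l _ = 1%:M) ?mul1mx ?subrr //.
by apply/rowP => s; rewrite !mxE [s]ord1 !eqxx.
Qed.

Lemma card_three (i j k : 'I_d) : i != j -> k != i -> k != j ->
  (forall l, [\/ l = i, l = j | l = k]) -> d = 3.
Proof.
move=> ij ki kj ijk; rewrite -[LHS]card_ord -cardsT.
have -> : [set: 'I_d]%SET = [set i; j; k]%SET.
  by apply/setP => l; rewrite !inE; have [->|->|->] := ijk l; rewrite eqxx ?orbT.
by rewrite finset.setUC cardsU1 !inE (negPf ki) (negPf kj) cards2 ij.
Qed.

Lemma isomorphic_of_rank : derived L <> [set 0] ->
  (\dim (jacobi_space C) + 2)%N = d ->
  [\/ lie_isomorphic L (heisenberg1 K * abelian_lie K (\dim {: L} - 3)%N)%type,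
      lie_isomorphic L (lie_L58 K)
    | lie_isomorphic L (lie_L626 K)].
Proof.
move=> L2 rd; have [i [j [ij z0]]] := noncommuting_cX C L2.
(* This is stated for any non-commuting pair because it is applied to [(i, j)] and to [(j, i)]. *)
have step i' j' k : i' != j' -> lie (X i') (X j') <> 0 ->
    lie (X i') (X k) \notin <[lie (X i') (X j')]>%VS ->
  lie_isomorphic L (lie_L58 K) \/ lie_isomorphic L (lie_L626 K).
  move=> ij' z0' wz.
  have ki : k != i' by apply: contraNneq wz => ->; rewrite liexx mem0v.
  have kj : k != j' by apply: contraNneq wz => ->; rewrite memv_line.
  have ijk := generators_le3 z0' rd ki kj wz.
  apply: (isomorphic_L58_L626 (card_three ij' ki kj ijk) ijk).
  by apply: free_pair wz; apply/eqP.
have [[k wz]|xX] := EM (exists k, lie (X i) (X k) \notin <[lie (X i) (X j)]>%VS).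
  by case: (step i j k ij z0 wz); [apply: Or32|apply: Or33].
have [[k wz]|yX] := EM (exists k, lie (X j) (X k) \notin <[lie (X j) (X i)]>%VS).
  have z0' : lie (X j) (X i) <> 0 by rewrite lieC => /eqP; rewrite oppr_eq0 => /eqP.
  by rewrite eq_sym in ij; case: (step j i k ij z0' wz); [apply: Or32|apply: Or33].
apply: Or31; apply: (isomorphic_heisenberg_of_rank ij z0 rd) => k.
  by apply/vlineP; apply: contrapT => /negP wz; apply: xX; exists k.
have /vlineP[a ->] : lie (X j) (X k) \in <[lie (X j) (X i)]>%VS.
  by apply: contrapT => /negP wz; apply: yX; exists k.
by exists (- a); rewrite scaleNr lieC scalerN.
Qed.

End Classification.

(** * Coordinates on the three algebras *)

Lemma lie_isomorphic_inverse (K : fieldType) (L M : lieAlgType K) :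
  lie_isomorphic L M ->
  exists (f : {linear L -> M}) (g : {linear M -> L}),
    [/\ lie_morphism f, lie_morphism g, cancel f g & cancel g f].
Proof.
move=> [f [fM [g fK gK]]].
have gL : linear g by move=> a x y; apply: (can_inj fK); rewrite linearP !gK.
pose G : {linear M -> L} := HB.pack g (GRing.isLinear.Build _ _ _ _ g gL).
exists f, G; split=> // x y.
by apply: (can_inj fK); rewrite fM !gK.
Qed.

(** Products involve only the first three basis vectors and their values fill the last [m], so the
    first three coordinates describe L / L^2. As [table_lie] adds one to its index, [m.+2] gives
    rows of length 3 + m. *)
Lemma exists_coords_table (K : fieldType) (L : lieAlgType K) m t
    (phi : {linear L -> 'rV[K]_(3 + m)}) (psi : {linear 'rV[K]_(3 + m) -> L}) :
  cancel phi psi -> cancel psi phi ->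
  (forall x y, phi (lie x y) = @table_lie K m.+2 t (phi x) (phi y)) ->
  all (fun p => [&& (p.1.1 < 3)%N, (p.1.2 < 3)%N & (3 <= p.2 < 3 + m)%N]) t ->
  (forall k : 'I_m, exists a b,
     @table_lie K m.+2 t a b = delta_mx 0 (rshift 3 k)) ->
  exists C : coords L 3 m, True.
Proof.
move=> phiK psiK phiM /allP tP tk.
have psiM x y : lie (psi x) (psi y) = psi (@table_lie K m.+2 t x y).
  by apply: (can_inj phiK); rewrite phiM !psiK.
have lie0 x y : lsubmx (phi x) = 0 -> lie x y = 0.
  move=> x0; apply: (can_inj phiK); rewrite phiM linear0.
  rewrite /table_lie big_seq big1 // => p /tP/and3P[p1 p2 _].
  have x0' i : (i < 3)%N -> phi x 0 (inord i : 'I_m.+3) = 0.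
    move=> i3; move/rowP/(_ (Ordinal i3)): x0; rewrite !mxE => <-; congr (phi x _ _).
    by apply: val_inj; rewrite /= inordK // (leq_trans i3).
  by rewrite !x0' // !mul0r subrr scale0r.
have [x y|x x0|C _] := coords_of_split phiK psiK _ lie0 _; last by exists C.
- apply/rowP => i; rewrite phiM /table_lie linear_sum summxE big_seq big1 ?mxE //.
  move=> p /tP/and3P[_ _ /andP[p2 p3]]; rewrite !mxE.
  rewrite [_ == inord _](_ : _ = false) ?andbF ?mulr0 //.
  by apply/eqP => /(congr1 val); rewrite /= inordK //; have := ltn_ord i; lia.
- rewrite -[x]phiK [phi x]row_sum_delta linear_sum big_split_ord /=.
  apply: (subspaceD (derived_subspace L)); apply: (subspace_sum (derived_subspace L)) => i _.
    move/rowP/(_ i): x0; rewrite !mxE => ->; rewrite scale0r linear0.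
    exact: subspace0 (derived_subspace L).
  rewrite linearZ; apply: (subspaceZ (derived_subspace L)).
  have [a [b <-]] := tk i; rewrite -psiM; exact: derivedP.
Qed.

Lemma eq_inord n a b : (a <= n)%N -> (b <= n)%N ->
  (inord a == inord b :> 'I_n.+1) = (a == b).
Proof.
by move=> an bn; apply/eqP/eqP => [/(congr1 (@nat_of_ord _))|->//]; rewrite !inordK.
Qed.

Lemma exists_coords_L58 (K : fieldType) (L : lieAlgType K) :
  lie_isomorphic L (lie_L58 K) -> exists C : coords L 3 2, True.
Proof.
move=> /lie_isomorphic_inverse[f [g [fM gM fK gK]]].
apply: (@exists_coords_table K L 2 table_L58 f g) => // k.
(* In this table the product of e_0 and e_(k + 1) is e_(k + 3). *)
exists (delta_mx 0 ord0).
have o0 : ord0 = inord 0 :> 'I_5 by apply: val_inj; rewrite /= inordK.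
exists (delta_mx 0 (inord k.+1)).
have k4 : (k.+1 <= 4)%N by rewrite (leq_trans (ltn_ord k)).
rewrite o0 /table_lie !big_cons big_nil /= !mxE !eqxx !(@eq_inord 4) //=.
case: k k4 => [[|[|//]] k2] _ /=.
  rewrite ?mulr0 ?mul0r ?mulr1 ?subrr ?subr0 ?scale0r ?scale1r ?addr0 ?add0r.
  by congr (delta_mx _ _); apply: val_inj; rewrite /= inordK.
rewrite ?mulr0 ?mul0r ?mulr1 ?subrr ?subr0 ?scale0r ?scale1r ?addr0 ?add0r.
by congr (delta_mx _ _); apply: val_inj; rewrite /= inordK.
Qed.

Lemma exists_coords_L626 (K : fieldType) (L : lieAlgType K) :
  lie_isomorphic L (lie_L626 K) -> exists C : coords L 3 3, True.
Proof.
move=> /lie_isomorphic_inverse[f [g [fM gM fK gK]]].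
apply: (@exists_coords_table K L 3 table_L626 f g) => // k.
have tableE i j : (i <= 5)%N -> (j <= 5)%N ->
    @table_lie K 5 table_L626 (delta_mx 0 (inord i)) (delta_mx 0 (inord j)) =
    table_coef K (0, 1, 3)%N i j *: delta_mx 0 (inord 3)
    + table_coef K (0, 2, 4)%N i j *: delta_mx 0 (inord 4)
    + table_coef K (1, 2, 5)%N i j *: delta_mx 0 (inord 5).
  move=> i5 j5; rewrite /table_lie !big_cons big_nil addr0 addrA.
  rewrite !mxE /= !(@eq_inord 5) // -!natrM !mulnb /table_coef /=.
  by rewrite ![_ == i]eq_sym ![_ == j]eq_sym.
case: k => [[|[|[|//]]] k3] /=.
- exists (delta_mx 0 (inord 0)), (delta_mx 0 (inord 1)); rewrite tableE // /table_coef /=.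
  rewrite ?subrr ?subr0 ?scale0r ?scale1r ?addr0 ?add0r.
  by congr (delta_mx _ _); apply: val_inj; rewrite /= inordK.
- exists (delta_mx 0 (inord 0)), (delta_mx 0 (inord 2)); rewrite tableE // /table_coef /=.
  rewrite ?subrr ?subr0 ?scale0r ?scale1r ?addr0 ?add0r.
  by congr (delta_mx _ _); apply: val_inj; rewrite /= inordK.
- exists (delta_mx 0 (inord 1)), (delta_mx 0 (inord 2)); rewrite tableE // /table_coef /=.
  rewrite ?subrr ?subr0 ?scale0r ?scale1r ?addr0 ?add0r.
  by congr (delta_mx _ _); apply: val_inj; rewrite /= inordK.
Qed.

Lemma exists_coords_heisenberg (K : fieldType) (L : lieAlgType K) N :
  lie_isomorphic L (heisenberg1 K * abelian_lie K N)%type ->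
  exists C : coords L (2 + N) 1, (\dim (jacobi_space C) + 2)%N = (2 + N)%N.
Proof.
move=> /lie_isomorphic_inverse[f [g [fM gM fK gK]]].
(* The vector z of H(1) spans L^2 and must come last, so the abelian block is placed between x, y
   and z. *)
pose phi l : 'rV[K]_((2 + N) + 1) :=
  row_mx (row_mx (lsubmx ((f l).1 : 'rV[K]_(2 + 1))) (f l).2)
    (rsubmx ((f l).1 : 'rV[K]_(2 + 1))).
pose psi (w : 'rV[K]_((2 + N) + 1)) : L :=
  g (row_mx (lsubmx (lsubmx w)) (rsubmx w) : 'rV[K]_(2 + 1), rsubmx (lsubmx w)).

have phiL : linear phi.
  by move=> a x y; rewrite /phi linearP /= !linearP -!add_row_mx -!scale_row_mx.
have psiL : linear psi.
  move=> a x y; rewrite /psi -linearP; congr (g (_, _)); last by rewrite !linearP.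
  by rewrite !linearP -add_row_mx -scale_row_mx.
pose Phi : {linear L -> _} := HB.pack phi (GRing.isLinear.Build _ _ _ _ phi phiL).
pose Psi : {linear 'rV[K]_((2 + N) + 1) -> L} :=
  HB.pack psi (GRing.isLinear.Build _ _ _ _ psi psiL).
have phiK : cancel Phi Psi.
  by move=> l; rewrite /= /psi /phi !row_mxKl !row_mxKr hsubmxK -surjective_pairing fK.
have psiK : cancel Psi Phi.
  by move=> w; rewrite /= /psi /phi gK /= row_mxKl row_mxKr !hsubmxK.
pose det (l l' : L) := (f l).1 0 (inord 0) * (f l').1 0 (inord 1)
  - (f l).1 0 (inord 1) * (f l').1 0 (inord 0).
have fE l l' : f (lie l l') = det l l' *: ((delta_mx 0 (inord 2) : heisenberg1 K), 0).
  rewrite fM; congr (_, _); last by rewrite /= scaler0.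
  by rewrite /= -[LHS]/(table_lie table_H1 _ _) /table_lie big_cons big_nil addr0.
have lphi l (i : 'I_2) : lsubmx (Phi l) 0 (lshift N i) = (f l).1 0 (lshift 1 i).
  by rewrite /= /phi row_mxKl row_mxEl mxE.
have inord0 : inord 0 = lshift 1 (ord0 : 'I_2) by apply: val_inj; rewrite /= inordK.
have inord1 : inord 1 = lshift 1 (ord_max : 'I_2) by apply: val_inj; rewrite /= inordK.
have detE l l' : det l l' =
    lsubmx (Phi l) 0 (lshift N ord0) * lsubmx (Phi l') 0 (lshift N ord_max)
    - lsubmx (Phi l) 0 (lshift N ord_max) * lsubmx (Phi l') 0 (lshift N ord0).
  by rewrite !lphi /det inord0 inord1.
pose X i : L := Psi (delta_mx 0 (lshift 1 (lshift N i))).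
have XE : f (lie (X ord0) (X ord_max)) = ((delta_mx 0 (inord 2) : heisenberg1 K), 0).
  rewrite fE detE !psiK !mxE /= mulr1 mulr0 subr0.
  by rewrite scale1r.
have phiX : Phi (lie (X ord0) (X ord_max)) = row_mx 0 1%:M.
  rewrite /= /phi XE /=; congr row_mx; apply/rowP => i.
    rewrite !mxE; case: splitP => k ik; rewrite !mxE //= -val_eqE /= inordK //.
    by rewrite ltn_eqF ?ltn_ord.
  by rewrite !mxE /= -val_eqE /= inordK // [i]ord1.
have lieE l l' : lie l l' = det l l' *: lie (X ord0) (X ord_max).
  by apply: (can_inj fK); rewrite linearZ /= XE fE.
have [l l'|l l' l0|l l0|C [Cv CX]] := coords_of_split phiK psiK _ _ _.
- by rewrite lieE linearZ phiX linearZ /= row_mxKl scaler0.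
- by rewrite lieE detE l0 !mxE !mul0r subrr scale0r.
- suff -> : l = rsubmx (Phi l) 0 0 *: lie (X ord0) (X ord_max).
    by apply: (subspaceZ (derived_subspace L)); apply: derivedP.
  apply: (can_inj phiK); rewrite linearZ phiX -{1}[Phi l]hsubmxK l0.
  rewrite [RHS]scale_row_mx scaler0; congr (row_mx _ _).
  by rewrite {1}[rsubmx _]mx11_scalar scale_scalar_mx mulr1.
have XC i : cX C (lshift N i) = X i by rewrite CX.
exists C.
apply: (heisenberg_rank (i0 := lshift N ord0) (j0 := lshift N ord_max)).
- by rewrite eq_lshift.
- rewrite !XC => /(congr1 f); rewrite XE linear0 => -[] /rowP/(_ (inord 2))/eqP.
  by rewrite !mxE !eqxx oner_eq0.
- by move=> l l'; rewrite !XC lieE detE !Cv.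
Qed.

(** * Arithmetic of the dimension formula and the final equivalence *)

Lemma multiplier_dimension_rank (d m r k : nat) : (k + m + r = 'C(d, 2) + d * m)%N ->
  k%:R = 1 / 2 * ((d + m)%N%:R + m%:R - 2) * ((d + m)%N%:R - m%:R - 1) + 1 :> rat <->
  (r + 2)%N = d.
Proof.
move=> /(congr1 (fun n => n%:R : rat)); rewrite !natrD natrM => e.
have {}c : 2 * 'C(d, 2)%:R = d%:R * d%:R - d%:R :> rat.
  have : (2 * 'C(d, 2) + d = d * d)%N.
    by elim: d {e} => // d IH; rewrite binS bin1; lia.
  by move=> /(congr1 (fun n => n%:R : rat)); rewrite natrD !natrM => <-; rewrite addrK.
(* With n = d + m the formula reads k = C(d, 2) + d m - m - d + 2, to be compared with k = C(d, 2) +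
   d m - m - r from the hypothesis. *)
split=> [ke|/(congr1 (fun n => n%:R : rat))]; last by rewrite /= !natrD => rd; lra.
by apply/eqP; rewrite -(Num.Theory.eqr_nat rat) natrD; apply/eqP; lra.
Qed.

Theorem theorem2p22 (K : fieldType) (L : finLieAlgType K) (n m : nat)
    (dimL : \dim {: L} = n) (class2 : nilpotent_of_class L 2)
    (dimL2 : has_dim (derived L) m) (P : free_presentation L) :
  (exists d : nat, dim_schur_multiplier P d /\
     d%:R = 1 / 2 * (n%:R + m%:R - 2) * (n%:R - m%:R - 1) + 1 :> rat)
  <->
  [\/ lie_isomorphic L (heisenberg1 K * abelian_lie K (n - 3)%N)%type,
      lie_isomorphic L (lie_L58 K)
    | lie_isomorphic L (lie_L626 K)].
Proof.
have L2 : derived L <> [set 0] by apply: (class2.2 1%N).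
split=> [[k [Pk ke]]|iso].
  have [d [C _]] := exists_coords class2 dimL2.
  rewrite -dimL; apply: (isomorphic_of_rank (C := C) L2).
  move/(dim_schur_coords C): Pk => /multiplier_dimension_rank rk.
  by apply/rk; rewrite -(coords_dim C) dimL.
(* For the converse it suffices to find coordinates of rank d - 2. The Heisenberg case provides them
   directly; with three generators the rank is squeezed by d - 2 <= r <= 1. *)
have [d [m' [C rd]]] : exists d m' (C : coords L d m'), (\dim (jacobi_space C) + 2)%N = d.
  have rank3 m' (C : coords L 3 m') : (\dim (jacobi_space C) + 2)%N = 3.
    have [i [j [ij z0]]] := noncommuting_cX C L2.
    by apply/eqP; rewrite eqn_leq (jacobi_rank_ge z0) andbT (leq_add2r 2 _ 1) jacobi_rank3.
  case: iso => [/exists_coords_heisenberg[C rd]|/exists_coords_L58[C _]|].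
  - by exists (2 + (n - 3))%N, 1%N, C.
  - by exists 3, 2, C.
  move=> /exists_coords_L626[C _].
  by exists 3, 3, C.
(* Coordinates obtained from the isomorphism come with their own [m']; both numbers are the
   dimension of L^2. *)
have m'm : m = m' by apply/(coords_has_dim C).
subst m'.
exists (\dim (lker (linfun (cover_relations C)))); split.
  by apply/(dim_schur_coords C)/dim_cover_relations.
rewrite -dimL (coords_dim C); have [_ kE] := multiplier_dimension_rank (dim_cover_relations C).
exact: kE rd.
Qed.
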